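(* Let $R_N$ be a regular $2N$-gon with unit sides, let $\mathbb T$ be any rhombus tiling of $R_N$, and let $\Lambda^{R_N}$ be the response matrix of the electrical network $G_{\mathbb T}$. Then for all $1\le p,q\le N$, with $d=|p-q|$, $$\Lambda^{R_N}_{p,q}=\frac{\sin(\pi/N)}{N\,\sin\big((2d-1)\pi/(2N)\big)\,\sin\big((2d+1)\pi/(2N)\big)}.$$
   Context: Rhombus tilings and electrical networks: $R$ is a polygonal region tiled by a rhombus tiling $\mathbb T$ with all sides of length 1; the vertices of $\mathbb T$ are colored black and white bipartitely. $G_{\mathbb T}$ is the graph whose vertices are the black vertices of $\mathbb T$ and whose edges are the diagonals $AC$ of rhombi $ABCD$ with $A,C$ black; this edge is a resistor of resistance $|AC|/|BD|$. The black vertices on the boundary of $R$ are $B_1,\dots,B_N$ in clockwise order. Applying voltage 1 at $B_p$ and 0 at all other boundary vertices and solving by Ohm's and Kirchhoff's laws, $\Lambda^R_{p,q}$ is the current flowing out of the network at $B_q$ (so $\Lambda^R_{p,q}\ge0$ for $p\neq q$, and $\Lambda^R_{p,p}\le 0$ is minus the current entering at $B_p$). The matrix $\Lambda^R=(\Lambda^R_{p,q})$ is the response matrix. *)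

(* Defs.v *)
From Stdlib Require Import Reals List Arith.
Import ListNotations.
Open Scope R_scope.

Definition pt := (R * R)%type.
Definition vadd (p q : pt) : pt := (fst p + fst q, snd p + snd q).
Definition vsub (p q : pt) : pt := (fst p - fst q, snd p - snd q).
Definition vscale (s : R) (p : pt) : pt := (s * fst p, s * snd p).
Definition det (p q : pt) : R := fst p * snd q - snd p * fst q.
Definition vnorm (p : pt) : R := sqrt (fst p * fst p + snd p * snd p).

Definition pt_eqb (p q : pt) : bool :=
  if Req_EM_T (fst p) (fst q) then
    if Req_EM_T (snd p) (snd q) then true else false
  else false.

(** The regular 2N-gon R_N with unit sides.  Side k (k = 0..2N-1) is the unit
    vector [side_dir N k] of angle k*pi/N; corners are listed counterclockwise,
    corner 0 = origin, corner (k+1) = corner k + side_dir N k. *)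
Definition side_dir (N : nat) (k : nat) : pt :=
  (cos (INR k * PI / INR N), sin (INR k * PI / INR N)).

Fixpoint corner (N : nat) (k : nat) : pt :=
  match k with
  | O => (0, 0)
  | S j => vadd (corner N j) (side_dir N j)
  end.

Definition in_poly (N : nat) (x : pt) : Prop :=
  forall k, (k < 2 * N)%nat -> 0 <= det (side_dir N k) (vsub x (corner N k)).

Definition on_bdry (N : nat) (x : pt) : Prop :=
  in_poly N x /\
  exists k, (k < 2 * N)%nat /\ det (side_dir N k) (vsub x (corner N k)) = 0.

Record rhombus := Rhomb { rb : pt; ru : pt; rv : pt }.

Definition rA (t : rhombus) : pt := rb t.
Definition rB (t : rhombus) : pt := vadd (rb t) (ru t).
Definition rC (t : rhombus) : pt := vadd (vadd (rb t) (ru t)) (rv t).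
Definition rD (t : rhombus) : pt := vadd (rb t) (rv t).
Definition verts (t : rhombus) : list pt := [rA t; rB t; rC t; rD t].

Definition unit_rhombus (t : rhombus) : Prop :=
  vnorm (ru t) = 1 /\ vnorm (rv t) = 1 /\ det (ru t) (rv t) <> 0.

Definition closed_rhombus (t : rhombus) (x : pt) : Prop :=
  exists s w, 0 <= s <= 1 /\ 0 <= w <= 1 /\
    x = vadd (rb t) (vadd (vscale s (ru t)) (vscale w (rv t))).

Definition open_rhombus (t : rhombus) (x : pt) : Prop :=
  exists s w, 0 < s < 1 /\ 0 < w < 1 /\
    x = vadd (rb t) (vadd (vscale s (ru t)) (vscale w (rv t))).

(** An (edge-to-edge) tiling of R_N by rhombi with unit sides, given as a list
    of tiles. *)
Definition rhombus_tiling (N : nat) (T : list rhombus) : Prop :=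
  (forall t, In t T -> unit_rhombus t) /\
  (forall x, in_poly N x <-> exists t, In t T /\ closed_rhombus t x) /\
  (forall i j x, (i < j)%nat -> (j < length T)%nat ->
     open_rhombus (nth i T (Rhomb (0,0) (0,0) (0,0))) x ->
     open_rhombus (nth j T (Rhomb (0,0) (0,0) (0,0))) x -> False) /\
  (forall t t' p, In t T -> In t' T -> In p (verts t) ->
     closed_rhombus t' p -> In p (verts t')).

Definition is_vertex (T : list rhombus) (x : pt) : Prop :=
  exists t, In t T /\ In x (verts t).

(** Bipartite colouring of the vertices (true = black). *)
Definition proper_colouring (T : list rhombus) (col : pt -> bool) : Prop :=
  forall t, In t T ->
    col (rA t) <> col (rB t) /\ col (rB t) <> col (rC t) /\
    col (rC t) <> col (rD t) /\ col (rD t) <> col (rA t).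

(** The edge of G_T contributed by a rhombus: its black diagonal (p1,p2) and
    its conductance = 1 / resistance = |other diagonal| / |black diagonal|. *)
Definition black_diag (col : pt -> bool) (t : rhombus) : pt * pt * R :=
  if col (rA t) then
    (rA t, rC t, vnorm (vsub (ru t) (rv t)) / vnorm (vadd (ru t) (rv t)))
  else
    (rB t, rD t, vnorm (vadd (ru t) (rv t)) / vnorm (vsub (ru t) (rv t))).

Definition inflow (T : list rhombus) (col : pt -> bool) (V : pt -> R) (x : pt) : R :=
  fold_right Rplus 0 (map (fun t =>
    match black_diag col t with
    | (p1, p2, c) =>
        if pt_eqb x p1 then c * (V p2 - V p1)
        else if pt_eqb x p2 then c * (V p1 - V p2) else 0
    end) T).

(** B_p for p = 0..N-1 (the paper's B_{p+1}): the black corners in clockwise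
    order starting from the black corner number s. *)
Definition Bvert (N s p : nat) : pt :=
  corner N ((s + 2 * N - 2 * p) mod (2 * N)).

Definition dirichlet_sol (N : nat) (T : list rhombus) (col : pt -> bool)
    (s p : nat) (V : pt -> R) : Prop :=
  V (Bvert N s p) = 1 /\
  (forall x, is_vertex T x -> col x = true -> on_bdry N x ->
      x <> Bvert N s p -> V x = 0) /\
  (forall x, is_vertex T x -> col x = true -> ~ on_bdry N x ->
      inflow T col V x = 0).

(** Lambda_{p,q} = current flowing out of the network at B_q. *)
Definition response_entry (N : nat) (T : list rhombus) (col : pt -> bool)
    (s q : nat) (V : pt -> R) : R :=
  inflow T col V (Bvert N s q).

Definition natdist (p q : nat) : nat := (p - q + (q - p))%nat.

Definition response_formula (N d : nat) : R :=
  sin (PI / INR N) /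
  (INR N * sin ((2 * INR d - 1) * PI / (2 * INR N))
         * sin ((2 * INR d + 1) * PI / (2 * INR N))).

(* Main.v *)
Require Import Defs.
From Stdlib Require Import Reals List Arith.
From Stdlib Require Import Lia Lra Psatz Permutation ClassicalEpsilon.
From Coquelicot Require Import Coquelicot.
Open Scope R_scope.
Set Bullet Behavior "Strict Subproofs".

(** Identify the plane with the complex numbers and put [w = exp (i pi / N)], so that the
    corners of the polygon are joined by the unit vectors [w ^ k].  Call a function on
    the vertices discrete holomorphic if on every rhombus its differences along the two
    diagonals are proportional to the diagonals.  Its real part is then a harmonic
    voltage on the black graph, and its imaginary part on the white vertices is the
    conjugate function: the current entering a vertex telescopes around that vertex, hence
    vanishes at interior vertices and equals a difference of the imaginary part at
    the two neighbouring corners on the boundary.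

    The trapezoidal integral of a discrete holomorphic function is again discrete
    holomorphic.  Iterating it from the constant 1 gives, for each [n < N], such a function
    whose value at corner [k] is [w ^ (n k)]; the Fourier modes are thus extended to the
    interior of an arbitrary tiling.  Averaging them over [n] gives the voltage that is 1 at
    one black corner and 0 at the others, with currents differences of cotangents.
    Green's identity identifies the response of any other Dirichlet solution with it.

    The potential of an edge function that is closed around every tile is defined
    by descending along edges to lower vertices; independence of the path is local
    confluence at each vertex, since two neighbouring descending edges span a tile. *)

(** * Unit rhombi seen from their vertices *)

Definition unit_vec (a : C) : Prop := fst a * fst a + snd a * snd a = 1.

(** Tiles may be recorded with either orientation; for a unit rhombus this normalisation makes the
    determinant of the two sides positive. *)
Definition ccw_sides (t : rhombus) : C * C :=
  if Rlt_dec 0 (det (ru t) (rv t)) then (ru t, rv t) else (rv t, ru t).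

(** The two sides of [t] issuing from its vertex [x], in counterclockwise order. *)
Definition tile_corner (t : rhombus) (x : C) : option (C * C) :=
  let P : C := rb t in
  let u := fst (ccw_sides t) in
  let v := snd (ccw_sides t) in
  if pt_eqb x P then Some (u, v)
  else if pt_eqb x (P + u)%C then Some (v, - u)%C
  else if pt_eqb x (P + u + v)%C then Some (- u, - v)%C
  else if pt_eqb x (P + v)%C then Some (- v, u)%C
  else None.

Lemma pt_eqb_eq (p q : C) : pt_eqb p q = true <-> p = q.
Proof.
  destruct p as [a b], q as [c d]; unfold pt_eqb; simpl.
  destruct (Req_EM_T a c), (Req_EM_T b d); split; intros H; try congruence;
    inversion H; congruence.
Qed.

Lemma pt_eqb_refl (p : C) : pt_eqb p p = true.
Proof. now apply pt_eqb_eq. Qed.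

Lemma pt_eqb_neq (p q : C) : p <> q -> pt_eqb p q = false.
Proof.
  intros H; destruct (pt_eqb p q) eqn:E; auto. now apply pt_eqb_eq in E.
Qed.

Lemma vnorm_unit (a : C) : vnorm a = 1 -> unit_vec a.
Proof.
  unfold vnorm, unit_vec; intros H.
  rewrite <- (sqrt_sqrt (fst a * fst a + snd a * snd a)) by nra.
  now rewrite H, Rmult_1_l.
Qed.

Ltac coords :=
  repeat match goal with
    | x : C |- _ => destruct x
    | x : pt |- _ => destruct x
    | x : (R * R)%type |- _ => destruct x
  end;
  unfold unit_vec, det, vsub, vadd, vscale, Cminus, Cplus, Copp, Cmult, RtoC in *;
  simpl in *.

Lemma ccw_sides_spec (t : rhombus) (u v : C) :
  unit_rhombus t -> ccw_sides t = (u, v) ->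
  unit_vec u /\ unit_vec v /\ 0 < det u v /\
  (ru t = u /\ rv t = v \/ ru t = v /\ rv t = u).
Proof.
  intros (Hu & Hv & Hd). apply vnorm_unit in Hu, Hv. unfold ccw_sides.
  destruct (Rlt_dec 0 _) as [h|h]; intros E; inversion E; subst; clear E.
  - auto 8.
  - split; [exact Hv|split; [exact Hu|split; [|auto]]].
    assert (det (rv t) (ru t) = - det (ru t) (rv t)) by (unfold det; ring).
    apply Rdichotomy in Hd. destruct Hd; [lra|contradiction].
Qed.

Lemma tile_corner_cases (t : rhombus) (x a b : C) :
  unit_rhombus t -> tile_corner t x = Some (a, b) ->
  exists u v : C, ccw_sides t = (u, v) /\
    ((x = rb t /\ a = u /\ b = v) \/
     (x = (rb t + u)%C /\ a = v /\ b = (- u)%C) \/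
     (x = (rb t + u + v)%C /\ a = (- u)%C /\ b = (- v)%C) \/
     (x = (rb t + v)%C /\ a = (- v)%C /\ b = u)).
Proof.
  intros Ht. unfold tile_corner.
  destruct (ccw_sides t) as [u v] eqn:E; simpl. intros H. exists u, v. split; auto.
  destruct (pt_eqb x (rb t)) eqn:E1.
  { apply pt_eqb_eq in E1. inversion H; subst a b. auto. }
  destruct (pt_eqb x (rb t + u)%C) eqn:E2.
  { apply pt_eqb_eq in E2. inversion H; subst a b. auto. }
  destruct (pt_eqb x (rb t + u + v)%C) eqn:E3.
  { apply pt_eqb_eq in E3. inversion H; subst a b. auto 6. }
  destruct (pt_eqb x (rb t + v)%C) eqn:E4; [|congruence].
  apply pt_eqb_eq in E4. inversion H; subst a b. auto 7.
Qed.

(** The cascade of tests never stops too early because the four vertices are distinct: the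
    difference of any two has a nonzero determinant with [u] or [v]. *)
Lemma tile_corner_values (t : rhombus) (u v : C) :
  unit_rhombus t -> ccw_sides t = (u, v) ->
  tile_corner t (rb t) = Some (u, v) /\
  tile_corner t (rb t + u)%C = Some (v, - u)%C /\
  tile_corner t (rb t + u + v)%C = Some (- u, - v)%C /\
  tile_corner t (rb t + v)%C = Some (- v, u)%C.
Proof.
  intros Ht E. destruct (ccw_sides_spec t u v Ht E) as (Hu & Hv & Hd & _).
  unfold tile_corner. rewrite E. simpl. rewrite !pt_eqb_refl.
  assert (N : forall p q : C, det (p - q)%C u <> 0 \/ det (p - q)%C v <> 0 ->
            pt_eqb p q = false).
  { intros p q Hpq. apply pt_eqb_neq. intros ->.
    destruct Hpq as [h|h]; apply h; coords; ring. }
  rewrite (N (rb t + u)%C), (N (rb t + u + v)%C (rb t)), (N (rb t + u + v)%C (rb t + u)%C),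
    (N (rb t + v)%C (rb t)), (N (rb t + v)%C (rb t + u)%C),
    (N (rb t + v)%C (rb t + u + v)%C); auto;
  destruct (rb t); coords; try (left; intro; lra); try (right; intro; lra).
Qed.

Lemma tile_corner_complete (t : rhombus) (x : C) :
  unit_rhombus t -> In x (verts t) -> exists a b, tile_corner t x = Some (a, b).
Proof.
  intros Ht Hx. destruct (ccw_sides t) as [u v] eqn:E.
  destruct (tile_corner_values t u v Ht E) as (V1 & V2 & V3 & V4).
  destruct (ccw_sides_spec t u v Ht E) as (_ & _ & _ & S).
  unfold verts, rA, rB, rC, rD in Hx.
  change vadd with Cplus in Hx.
  destruct S as [[E1 E2]|[E1 E2]]; rewrite E1, E2 in Hx; simpl in Hx;
    destruct Hx as [<-|[<-|[<-|[<-|[]]]]]; eauto.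
  replace (rb t + v + u)%C with (rb t + u + v)%C by ring. eauto.
Qed.

Lemma tile_corner_frame (t : rhombus) (x a b : C) :
  unit_rhombus t -> tile_corner t x = Some (a, b) ->
  unit_vec a /\ unit_vec b /\ 0 < det a b.
Proof.
  intros Ht H. destruct (tile_corner_cases _ _ _ _ Ht H) as (u & v & E & S).
  destruct (ccw_sides_spec t u v Ht E) as (Hu & Hv & Hd & _).
  destruct S as [(_ & -> & ->)|[(_ & -> & ->)|[(_ & -> & ->)|(_ & -> & ->)]]];
    repeat split; auto; clear H; coords; nra.
Qed.

Lemma Cplus_opp_cancel (x a : C) : (x + a + - a)%C = x.
Proof. ring. Qed.

(** One counterclockwise step around the tile; the four corners form a single orbit of it. *)
Lemma tile_corner_next (t : rhombus) (x a b : C) :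
  unit_rhombus t -> tile_corner t x = Some (a, b) ->
  tile_corner t (x + a)%C = Some (b, - a)%C.
Proof.
  intros Ht H. destruct (tile_corner_cases _ _ _ _ Ht H) as (u & v & E & S).
  destruct (tile_corner_values t u v Ht E) as (V1 & V2 & V3 & V4).
  destruct S as [(-> & -> & ->)|[(-> & -> & ->)|[(-> & -> & ->)|(-> & -> & ->)]]]; auto.
  - replace (rb t + u + v + - u)%C with (rb t + v)%C by ring.
    rewrite V4. do 2 f_equal. ring.
  - rewrite Cplus_opp_cancel. rewrite V1. do 2 f_equal. ring.
Qed.

Lemma tile_corner_prev (t : rhombus) (x a b : C) :
  unit_rhombus t -> tile_corner t x = Some (a, b) ->
  tile_corner t (x + b)%C = Some (- b, a)%C.
Proof.
  intros Ht H.
  (* One clockwise step is three counterclockwise steps. *)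
  pose proof (tile_corner_next _ _ _ _ Ht H) as H1.
  pose proof (tile_corner_next _ _ _ _ Ht H1) as H2.
  pose proof (tile_corner_next _ _ _ _ Ht H2) as H3.
  replace (x + a + b + - a)%C with (x + b)%C in H3 by ring.
  rewrite H3. do 2 f_equal. ring.
Qed.

Lemma tile_corner_vert (t : rhombus) (x a b : C) :
  unit_rhombus t -> tile_corner t x = Some (a, b) -> In x (verts t).
Proof.
  intros Ht H. destruct (tile_corner_cases _ _ _ _ Ht H) as (u & v & E & S).
  destruct (ccw_sides_spec t u v Ht E) as (_ & _ & _ & S').
  unfold verts, rA, rB, rC, rD. change vadd with Cplus. simpl.
  destruct S' as [[-> ->]|[-> ->]];
  destruct S as [(-> & _)|[(-> & _)|[(-> & _)|(-> & _)]]]; auto.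
  right; right; left. ring.
Qed.

Lemma tile_corner_closed (t : rhombus) (x a b y : C) :
  unit_rhombus t -> tile_corner t x = Some (a, b) -> closed_rhombus t y ->
  0 <= det (y - x)%C b /\ 0 <= det a (y - x)%C.
Proof.
  intros Ht H. destruct (tile_corner_cases _ _ _ _ Ht H) as (u & v & E & S).
  destruct (ccw_sides_spec t u v Ht E) as (_ & _ & Hd & S'). clear H E.
  intros Hy.
  assert (K : exists s w, 0 <= s <= 1 /\ 0 <= w <= 1 /\ y = (rb t + s * u + w * v)%C).
  { destruct Hy as (s & w & Hs & Hw & ->).
    destruct S' as [[-> ->]|[-> ->]]; [exists s, w|exists w, s]; repeat split; try tauto;
    destruct (rb t); coords; f_equal; ring. }
  destruct K as (s & w & Hs & Hw & ->). clear Hy S'.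
  assert (0 <= s * det u v) by nra. assert (0 <= w * det u v) by nra.
  assert (0 <= (1 - s) * det u v) by nra. assert (0 <= (1 - w) * det u v) by nra.
  destruct S as [(-> & -> & ->)|[(-> & -> & ->)|[(-> & -> & ->)|(-> & -> & ->)]]];
    destruct (rb t); coords; split; lra.
Qed.

Lemma tile_corner_open (t : rhombus) (x a b : C) (s w : R) :
  unit_rhombus t -> tile_corner t x = Some (a, b) -> 0 < s < 1 -> 0 < w < 1 ->
  open_rhombus t (x + s * a + w * b)%C.
Proof.
  intros Ht H Hs Hw. destruct (tile_corner_cases _ _ _ _ Ht H) as (u & v & E & S).
  destruct (ccw_sides_spec t u v Ht E) as (_ & _ & _ & S'). clear H E.
  assert (K : exists s' w', 0 < s' < 1 /\ 0 < w' < 1 /\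
     (x + s * a + w * b)%C = (rb t + s' * u + w' * v)%C).
  { destruct S as [(-> & -> & ->)|[(-> & -> & ->)|[(-> & -> & ->)|(-> & -> & ->)]]];
    [exists s, w|exists (1 - w), s|exists (1 - s), (1 - w)|exists w, (1 - s)];
    repeat split; try lra; destruct (rb t); coords; f_equal; ring. }
  destruct K as (s' & w' & Hs' & Hw' & ->).
  destruct S' as [[E1 E2]|[E1 E2]]; [exists s', w'|exists w', s']; rewrite E1, E2;
    repeat split; try tauto; destruct (rb t); coords; f_equal; ring.
Qed.

(** * Currents through a single tile *)

Definition tile_current (col : C -> bool) (V : C -> R) (x : C) (t : rhombus) : R :=
  match black_diag col t with
  | (p1, p2, c) =>
      if pt_eqb x p1 then c * (V p2 - V p1)
      else if pt_eqb x p2 then c * (V p1 - V p2) else 0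
  end.

Definition coloured_tile (col : C -> bool) (t : rhombus) : Prop :=
  col (rA t) <> col (rB t) /\ col (rB t) <> col (rC t) /\
  col (rC t) <> col (rD t) /\ col (rD t) <> col (rA t).

(** Opposite vertices of a tile have the same colour, so the black diagonal at a black vertex [x]
    joins it to [x + a + b]. This gives one formula for all four corners and both recorded
    orientations. *)
Lemma tile_current_corner col V (t : rhombus) (x a b : C) :
  unit_rhombus t -> coloured_tile col t -> col x = true ->
  tile_corner t x = Some (a, b) ->
  tile_current col V x t =
    vnorm (b - a)%C / vnorm (a + b)%C * (V (x + a + b)%C - V x).
Proof.
  intros Ht (C1 & C2 & C3 & C4) Hx H.
  destruct (tile_corner_cases _ _ _ _ Ht H) as (u & v & E & S).
  destruct (ccw_sides_spec t u v Ht E) as (_ & _ & Hd & S').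
  unfold tile_current, black_diag.
  unfold rA, rB, rC, rD in *.
  destruct t as [P u' v']; simpl in *.
  change vadd with Cplus in *. change vsub with Cminus in *.
  assert (N1 : (P : C) <> (P + u + v)%C).
  { clear - Hd. intros K. apply (f_equal (fun z => det (z - P)%C v)) in K.
    coords. lra. }
  assert (N2 : (P + u : C)%C <> (P + v)%C).
  { clear - Hd. intros K. apply (f_equal (fun z => det (z - P)%C v)) in K.
    coords. lra. }
  clear H E Ht.
  assert (X1 : (P + u + v + - u)%C = (P + v)%C) by ring.
  assert (X2 : (P + v + - v + u)%C = (P + u)%C) by ring.
  assert (X3 : (P + u + v + - u + - v)%C = (P : C)).
  { rewrite X1. apply Cplus_opp_cancel. }
  destruct S' as [[-> ->]|[-> ->]];
  destruct S as [(-> & -> & ->)|[(-> & -> & ->)|[(-> & -> & ->)|(-> & -> & ->)]]];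
  destruct (col P) eqn:HP.
  (* The colours rule out every case in which the black diagonal misses [x]. *)
  all: try congruence.
  all: try (replace (P + v + u)%C with (P + u + v)%C in * by ring).
  all: try congruence.
  all: try solve [exfalso; destruct (col (P + u)%C), (col (P + v)%C), (col (P + u + v)%C); congruence].
  all: rewrite ?pt_eqb_refl, ?(pt_eqb_neq (P + u) (P + v)), ?(pt_eqb_neq (P + v) (P + u)),
    ?(pt_eqb_neq (P + u + v) P) by congruence.
  all: rewrite ?X3, ?X2, ?X1; apply Rmult_eq_compat_r; unfold Rdiv;
    apply f_equal2; [|apply f_equal]; unfold vnorm; apply f_equal;
    clear; coords; ring.
Qed.

Lemma tile_current_off col V (t : rhombus) (x : C) :
  ~ In x (verts t) -> tile_current col V x t = 0.
Proof.
  intros H. unfold tile_current, black_diag, verts in *.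
  destruct (col (rA t)); rewrite !pt_eqb_neq; auto; intros ->; apply H; simpl; auto.
Qed.

Lemma inflow_cons t T col V x :
  inflow (t :: T) col V x = tile_current col V x t + inflow T col V x.
Proof. reflexivity. Qed.

(** * Tiles around a point of the polygon *)

(** Pigeonhole over scales: with finitely many candidates, a single one must serve arbitrarily small
    [e]. *)
Lemma frequently_in_list {A : Type} (l : list A) (P : A -> R -> Prop) :
  forall e0, 0 < e0 ->
  (forall e, 0 < e <= e0 -> exists t, In t l /\ P t e) ->
  exists t, In t l /\ forall h, 0 < h -> exists e, 0 < e <= h /\ P t e.
Proof.
  induction l as [|t l IH]; intros e0 He0 H.
  - destruct (H e0) as (t & [] & _); lra.
  - destruct (classic (forall h, 0 < h -> exists e, 0 < e <= h /\ P t e)) as [K|K].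
    + exists t; simpl; auto.
    + apply not_all_ex_not in K as [h K]. apply imply_to_and in K as [Hh K].
      destruct (IH (Rmin e0 h)) as (t' & Ht' & H').
      * apply Rmin_case; lra.
      * intros e He.
        assert (e <= e0) by (eapply Rle_trans; [apply He|apply Rmin_l]).
        assert (e <= h) by (eapply Rle_trans; [apply He|apply Rmin_r]).
        destruct (H e) as (t' & [<-|Ht'] & HP); [lra| |eauto].
        exfalso. apply K. exists e. split; [lra|auto].
      * exists t'; simpl; auto.
Qed.

Lemma small_linear_bound (A B D : R) :
  0 < A -> exists h, 0 < h /\ forall e, 0 < e <= h -> 0 <= A + e * (B + e * D).
Proof.
  intros HA. set (K := Rabs B + Rabs D + 1).
  assert (HK : 0 < K) by (unfold K; pose proof (Rabs_pos B); pose proof (Rabs_pos D); lra).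
  exists (Rmin 1 (A / K)). split.
  - apply Rmin_case; [lra|]. now apply Rdiv_lt_0_compat.
  - intros e He.
    assert (H1 : e <= 1) by (eapply Rle_trans; [apply He|apply Rmin_l]).
    assert (H2 : e <= A / K) by (eapply Rle_trans; [apply He|apply Rmin_r]).
    assert (e * K <= A).
    { apply (Rmult_le_compat_r K) in H2; [|lra]. unfold Rdiv in H2.
      rewrite Rmult_assoc, Rinv_l in H2; lra. }
    assert (- K <= B + e * D).
    { unfold K. unfold Rabs. destruct (Rcase_abs B), (Rcase_abs D); nra. }
    nra.
Qed.

Lemma frequently_quadratic_nonneg (A B D : R) :
  (forall h, 0 < h -> exists e, 0 < e <= h /\ 0 <= A + e * (B + e * D)) -> 0 <= A.
Proof.
  intros H. apply Rnot_lt_le. intros HA.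
  destruct (small_linear_bound (- A / 2) (- B) (- D)) as (h & Hh & K); [lra|].
  destruct (H h Hh) as (e & He & L). specialize (K e He). lra.
Qed.

(** The sign of a quadratic just to the right of 0 is that of its first nonzero coefficient. *)
Lemma eventually_quadratic_nonneg (A B D : R) :
  0 <= A -> (A = 0 -> 0 <= B) -> (A = 0 -> B = 0 -> 0 <= D) ->
  exists h, 0 < h /\ forall e, 0 < e <= h -> 0 <= A + e * (B + e * D).
Proof.
  intros HA HB HD. destruct (Req_dec A 0) as [->|NA].
  - destruct (Req_dec B 0) as [->|NB].
    + exists 1. split; [lra|]. intros e He. specialize (HD eq_refl eq_refl). nra.
    + destruct (small_linear_bound B D 0) as (h & Hh & K).
      * specialize (HB eq_refl). lra.
      * exists h. split; auto. intros e He. specialize (K e He). nra.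
  - apply small_linear_bound. lra.
Qed.

Lemma eventually_forall_lt (P : nat -> R -> Prop) (n : nat) :
  (forall k, (k < n)%nat -> exists h, 0 < h /\ forall e, 0 < e <= h -> P k e) ->
  exists h, 0 < h /\ forall e, 0 < e <= h -> forall k, (k < n)%nat -> P k e.
Proof.
  induction n as [|n IH]; intros H.
  - exists 1. split; [lra|]. intros; lia.
  - destruct IH as (h & Hh & K); [intros; apply H; lia|].
    destruct (H n) as (h' & Hh' & K'); [lia|].
    exists (Rmin h h'). split; [apply Rmin_case; lra|]. intros e He k Hk.
    assert (e <= h) by (eapply Rle_trans; [apply He|apply Rmin_l]).
    assert (e <= h') by (eapply Rle_trans; [apply He|apply Rmin_r]).
    destruct (Nat.eq_dec k n) as [->|Hne]; [apply K'; lra|apply K; [lra|lia]].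
Qed.

(** Cramer's rule for the coordinates [s] and [w], multiplied by [D * D] so that either sign of [D]
    is covered. The conditions are affine in [y], hence survive limits. *)
Lemma closed_rhombus_iff (t : rhombus) (y : C) :
  unit_rhombus t ->
  closed_rhombus t y <->
  let D := det (ru t) (rv t) in
  0 <= det (y - rb t)%C (rv t) * D /\ 0 <= D * D - det (y - rb t)%C (rv t) * D /\
  0 <= det (ru t) (y - rb t)%C * D /\ 0 <= D * D - det (ru t) (y - rb t)%C * D.
Proof.
  intros (_ & _ & Hd). cbv zeta.
  assert (HD : 0 < det (ru t) (rv t) * det (ru t) (rv t)) by nra.
  split.
  - intros (s & w & Hs & Hw & ->).
    replace (det (vadd (rb t) (vadd (vscale s (ru t)) (vscale w (rv t))) - rb t)%C (rv t))
      with (s * det (ru t) (rv t)) by (destruct t as [P u v]; coords; ring).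
    replace (det (ru t) (vadd (rb t) (vadd (vscale s (ru t)) (vscale w (rv t))) - rb t)%C)
      with (w * det (ru t) (rv t)) by (destruct t as [P u v]; coords; ring).
    repeat split; nra.
  - intros (H1 & H2 & H3 & H4).
    assert (K : forall X, 0 <= X * det (ru t) (rv t) ->
      0 <= det (ru t) (rv t) * det (ru t) (rv t) - X * det (ru t) (rv t) ->
      0 <= X / det (ru t) (rv t) <= 1).
    { intros X HX1 HX2.
      replace (X / det (ru t) (rv t)) with
        ((X * det (ru t) (rv t)) / (det (ru t) (rv t) * det (ru t) (rv t))) by (field; auto).
      split.
      - apply Rmult_le_pos; [auto|]. left. now apply Rinv_0_lt_compat.
      - apply Rmult_le_reg_r with (1 := HD). unfold Rdiv.
        rewrite Rmult_assoc, Rinv_l; lra. }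
    exists (det (y - rb t)%C (rv t) / det (ru t) (rv t)),
           (det (ru t) (y - rb t)%C / det (ru t) (rv t)).
    split; [auto|split; [auto|]]. clear - Hd.
    destruct t as [P u v]; simpl in *.
    destruct P as [p1 p2], u as [u1 u2], v as [v1 v2], y as [y1 y2].
    coords. f_equal; field; auto.
Qed.

Lemma in_poly_vertex N T x :
  rhombus_tiling N T -> is_vertex T x -> in_poly N x.
Proof.
  intros (HU & HC & _) (t & Ht & Hx). apply HC. exists t. split; auto.
  unfold verts in Hx. simpl in Hx.
  destruct Hx as [<-|[<-|[<-|[<-|[]]]]];
    [exists 0, 0|exists 1, 0|exists 1, 1|exists 0, 1]; repeat split; try lra;
    unfold rA, rB, rC, rD; destruct t as [P u v]; coords; f_equal; ring.
Qed.

(* The second-order term [e * e * p] singles out the tile on a prescribed side of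
   the ray from [x] in direction [a]; take [p = 0] if only the direction matters. *)
Lemma tile_towards N T (x a p : C) (e0 : R) :
  rhombus_tiling N T -> is_vertex T x -> 0 < e0 ->
  (forall e : R, 0 < e <= e0 -> in_poly N (x + e * a + e * e * p)%C) ->
  exists t (a' b' : C) (e : R), In t T /\ tile_corner t x = Some (a', b') /\
    0 <= det a b' /\ 0 <= det a' a /\ 0 < e /\
    0 <= det (a + e * p)%C b' /\ 0 <= det a' (a + e * p)%C.
Proof.
  intros HT Hx He0 H. pose proof HT as (HU & HC & HD & HE).
  destruct (frequently_in_list T (fun t e => closed_rhombus t (x + e * a + e * e * p)%C) e0)
    as (t & Ht & K); auto.
  { intros e He. apply HC. auto. }
  (* Letting [e] tend to 0 along the curve shows that [x] itself lies in the closed tile. *)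
  assert (Hxt : closed_rhombus t x).
  { apply closed_rhombus_iff; [auto|]. cbv zeta.
    assert (K' : forall h, 0 < h -> exists e, 0 < e <= h /\
       let D := det (ru t) (rv t) in let y := (x + e * a + e * e * p)%C in
  0 <= det (y - rb t)%C (rv t) * D /\ 0 <= D * D - det (y - rb t)%C (rv t) * D /\
  0 <= det (ru t) (y - rb t)%C * D /\ 0 <= D * D - det (ru t) (y - rb t)%C * D).
    { intros h Hh. destruct (K h Hh) as (e & He & Q). exists e. split; auto.
      apply closed_rhombus_iff in Q; auto. }
    cbv zeta in K'. set (D := det (ru t) (rv t)) in *.
    repeat split;
    [apply (frequently_quadratic_nonneg _ (det a (rv t) * D) (det p (rv t) * D))
    |apply (frequently_quadratic_nonneg _ (- (det a (rv t) * D)) (- (det p (rv t) * D)))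
    |apply (frequently_quadratic_nonneg _ (det (ru t) a * D) (det (ru t) p * D))
    |apply (frequently_quadratic_nonneg _ (- (det (ru t) a * D)) (- (det (ru t) p * D)))];
    intros h Hh; destruct (K' h Hh) as (e & He & Q1 & Q2 & Q3 & Q4); exists e; (split; [exact He|]);
    [clear - Q1|clear - Q2|clear - Q3|clear - Q4]; clearbody D; destruct t as [P u v]; coords; lra. }
  (* The tiling is edge-to-edge: a vertex lying in a tile is one of its vertices. *)
  assert (Hv : In x (verts t)).
  { destruct Hx as (t0 & Ht0 & Hx). eapply HE; eauto. }
  destruct (tile_corner_complete t x (HU t Ht) Hv) as (a' & b' & E).
  exists t, a', b'.
  assert (K' : forall h, 0 < h -> exists e, 0 < e <= h /\
     0 <= det a b' + e * (det p b' + e * 0) /\ 0 <= det a' a + e * (det a' p + e * 0)).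
  { intros h Hh. destruct (K h Hh) as (e & He & Q). exists e. split; auto.
    apply (tile_corner_closed t x a' b' _ (HU t Ht) E) in Q.
    replace (det (x + e * a + e * e * p - x)%C b')
      with (e * (det a b' + e * (det p b' + e * 0))) in Q by (clear; coords; ring).
    replace (det a' (x + e * a + e * e * p - x)%C)
      with (e * (det a' a + e * (det a' p + e * 0))) in Q by (clear; coords; ring).
    split; nra. }
  destruct (K' 1 Rlt_0_1) as (e & He & Q1 & Q2). exists e.
  repeat split; try tauto.
  - apply (frequently_quadratic_nonneg _ (det p b') 0). intros h Hh.
    destruct (K' h Hh) as (e' & He' & Q). exists e'. tauto.
  - apply (frequently_quadratic_nonneg _ (det a' p) 0). intros h Hh.
    destruct (K' h Hh) as (e' & He' & Q). exists e'. tauto.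
  - clear - Q1. coords; lra.
  - clear - Q2. coords; lra.
Qed.

(** * Overlapping cones at a common vertex *)

Definition disjoint_tiles (t t' : rhombus) : Prop :=
  forall y, open_rhombus t y -> open_rhombus t' y -> False.

Lemma tiling_disjoint N T : rhombus_tiling N T -> ForallOrdPairs disjoint_tiles T.
Proof.
  intros (_ & _ & HD & _).
  set (d := Rhomb (0, 0) (0, 0) (0, 0)) in HD.
  assert (K : forall i j, (i < j)%nat -> (j < length T)%nat ->
            disjoint_tiles (nth i T d) (nth j T d)).
  { intros i j Hi Hj y. now apply HD. }
  clear HD. induction T as [|t T IH]; constructor.
  - apply Forall_forall. intros t' Ht'. apply (In_nth _ _ d) in Ht' as (n & Hn & <-).
    apply (K 0%nat (S n)); simpl; lia.
  - apply IH. intros i j Hi Hj. apply (K (S i) (S j)); simpl; lia.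
Qed.

(** [d] lies strictly inside both cones, so a short enough step from [x] along [d] enters both
    tiles. *)
Lemma corners_overlap_point t t' (x a b a' b' d : C) :
  unit_rhombus t -> unit_rhombus t' ->
  tile_corner t x = Some (a, b) -> tile_corner t' x = Some (a', b') ->
  0 < det a d -> 0 < det d b -> 0 < det a' d -> 0 < det d b' ->
  exists y, open_rhombus t y /\ open_rhombus t' y.
Proof.
  intros Ht Ht' E E' H1 H2 H3 H4.
  destruct (tile_corner_frame _ _ _ _ Ht E) as (_ & _ & D).
  destruct (tile_corner_frame _ _ _ _ Ht' E') as (_ & _ & D').
  set (s := det d b / det a b). set (w := det a d / det a b).
  set (s' := det d b' / det a' b'). set (w' := det a' d / det a' b').
  assert (Hs : 0 < s) by (apply Rdiv_lt_0_compat; auto).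
  assert (Hw : 0 < w) by (apply Rdiv_lt_0_compat; auto).
  assert (Hs' : 0 < s') by (apply Rdiv_lt_0_compat; auto).
  assert (Hw' : 0 < w') by (apply Rdiv_lt_0_compat; auto).
  (* Dividing the four coordinates of [d] by their sum plus 1 makes each of them less than 1. *)
  set (k := s + w + s' + w' + 1). set (e := / k).
  assert (He : 0 < e) by (apply Rinv_0_lt_compat; unfold k; lra).
  assert (Hek : e * k = 1) by (unfold e; apply Rinv_l; unfold k; lra).
  exists (x + e * d)%C. split.
  - replace (x + e * d)%C with (x + (e * s)%R * a + (e * w)%R * b)%C.
    + apply tile_corner_open; auto; unfold k in Hek; split; nra.
    + unfold s, w. clear - D. clearbody e. coords. f_equal; field; lra.
  - replace (x + e * d)%C with (x + (e * s')%R * a' + (e * w')%R * b')%C.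
    + apply tile_corner_open; auto; unfold k in Hek; split; nra.
    + unfold s', w'. clear - D'. clearbody e. coords. f_equal; field; lra.
Qed.

Lemma tiles_overlap_eq N T t t' (x a b a' b' d : C) :
  rhombus_tiling N T -> In t T -> In t' T ->
  tile_corner t x = Some (a, b) -> tile_corner t' x = Some (a', b') ->
  0 < det a d -> 0 < det d b -> 0 < det a' d -> 0 < det d b' -> t = t'.
Proof.
  intros HT Ht Ht' E E' H1 H2 H3 H4. pose proof HT as (HU & _).
  destruct (corners_overlap_point t t' x a b a' b' d) as (y & Hy & Hy'); auto.
  destruct (ForallOrdPairs_In (tiling_disjoint _ _ HT) t t' Ht Ht') as [?|[D|D]]; auto;
    exfalso; eapply D; eauto.
Qed.

(** [a] turned slightly towards [b'] is a direction strictly inside both cones. *)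
Lemma shared_right_side t t' (x a b b' : C) :
  unit_rhombus t -> unit_rhombus t' ->
  tile_corner t x = Some (a, b) -> tile_corner t' x = Some (a, b') ->
  exists y, open_rhombus t y /\ open_rhombus t' y.
Proof.
  intros Ht Ht' E E'.
  destruct (tile_corner_frame _ _ _ _ Ht E) as (Ua & Ub & D).
  destruct (tile_corner_frame _ _ _ _ Ht' E') as (_ & Ub' & D').
  destruct (small_linear_bound (det a b) (det b' b) 0) as (h & Hh & K); auto.
  apply (corners_overlap_point t t' x a b a b' (a + (h / 2)%R * b')%C); auto;
    specialize (K h (conj Hh (Rle_refl _))).
  - replace (det a (a + (h / 2)%R * b')%C) with (h / 2 * det a b') by (clear; coords; ring).
    nra.
  - replace (det (a + (h / 2)%R * b')%C b) with (det a b + h / 2 * det b' b)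
      by (clear; coords; ring). nra.
  - replace (det a (a + (h / 2)%R * b')%C) with (h / 2 * det a b') by (clear; coords; ring).
    nra.
  - replace (det (a + (h / 2)%R * b')%C b') with (det a b') by (clear; coords; ring). auto.
Qed.

(** Mirror image: [b] is turned slightly towards [a']. *)
Lemma shared_left_side t t' (x a a' b : C) :
  unit_rhombus t -> unit_rhombus t' ->
  tile_corner t x = Some (a, b) -> tile_corner t' x = Some (a', b) ->
  exists y, open_rhombus t y /\ open_rhombus t' y.
Proof.
  intros Ht Ht' E E'.
  destruct (tile_corner_frame _ _ _ _ Ht E) as (Ua & Ub & D).
  destruct (tile_corner_frame _ _ _ _ Ht' E') as (_ & Ub' & D').
  destruct (small_linear_bound (det a b) (det a a') 0) as (h & Hh & K); auto.
  apply (corners_overlap_point t t' x a b a' b (b + (h / 2)%R * a')%C); auto;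
    specialize (K h (conj Hh (Rle_refl _))).
  - replace (det a (b + (h / 2)%R * a')%C) with (det a b + h / 2 * det a a')
      by (clear; coords; ring). nra.
  - replace (det (b + (h / 2)%R * a')%C b) with (h / 2 * det a' b) by (clear; coords; ring).
    nra.
  - replace (det a' (b + (h / 2)%R * a')%C) with (det a' b) by (clear; coords; ring). auto.
  - replace (det (b + (h / 2)%R * a')%C b) with (h / 2 * det a' b) by (clear; coords; ring).
    nra.
Qed.

(** * The star of a vertex *)

(** Pairs the right and left sides of the tiles at [x]. Where the tiles close up around [x], each
    edge occurs once in either role, which makes sums over the star telescope. *)
Fixpoint star (T : list rhombus) (x : C) : list (C * C) :=
  match T with
  | nil => nil
  | t :: T' =>
      match tile_corner t x with
      | Some ab => ab :: star T' x
      | None => star T' x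
      end
  end.

Definition edges (T : list rhombus) (x : C) : list C :=
  map fst (star T x) ++ map snd (star T x).

Lemma in_star T x ab :
  In ab (star T x) <-> exists t, In t T /\ tile_corner t x = Some ab.
Proof.
  induction T as [|t T IH]; simpl.
  - split; [tauto|]. intros (t & [] & _).
  - destruct (tile_corner t x) as [ab'|] eqn:E; simpl; rewrite IH; split.
    + intros [<-|(t' & H)]; [eauto|]. exists t'; tauto.
    + intros (t' & [<-|H] & H'); [left; congruence|eauto].
    + intros (t' & H); exists t'; tauto.
    + intros (t' & [<-|H] & H'); [congruence|eauto].
Qed.

Lemma in_edges T x w :
  In w (edges T x) <->
  exists t c, In t T /\ (tile_corner t x = Some (w, c) \/ tile_corner t x = Some (c, w)).
Proof.
  unfold edges. rewrite in_app_iff, !in_map_iff. split.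
  - intros [((a & b) & <- & H)|((a & b) & <- & H)]; apply in_star in H as (t & H & E); simpl; eauto.
  - intros (t & c & H & [E|E]); [left; exists (w, c)|right; exists (c, w)];
      (split; [auto|]); apply in_star; eauto.
Qed.

Lemma edges_unit N T x w : rhombus_tiling N T -> In w (edges T x) -> unit_vec w.
Proof.
  intros (HU & _) H. apply in_edges in H as (t & c & Ht & [E|E]);
  apply tile_corner_frame in E; auto; tauto.
Qed.

Lemma edges_source N T x w : rhombus_tiling N T -> In w (edges T x) -> is_vertex T x.
Proof.
  intros (HU & _) H. apply in_edges in H as (t & c & Ht & [E|E]);
  apply tile_corner_vert in E; auto; exists t; auto.
Qed.

Lemma edges_rev N T x w :
  rhombus_tiling N T -> In w (edges T x) -> In (- w)%C (edges T (x + w)%C).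
Proof.
  intros (HU & _) H. apply in_edges in H as (t & c & Ht & [E|E]);
  [apply tile_corner_next in E|apply tile_corner_prev in E]; auto; apply in_edges; eauto.
Qed.

(** Two tiles at [x] with the same right side, or with the same left side, would overlap. *)
Lemma star_sides_NoDup N T x :
  rhombus_tiling N T -> NoDup (map fst (star T x)) /\ NoDup (map snd (star T x)).
Proof.
  intros HT. pose proof (tiling_disjoint _ _ HT) as HD. destruct HT as (HU & _).
  induction HD as [|t T Ht HD IH]; simpl; [split; constructor|].
  destruct IH as [IH1 IH2]; [intros; apply HU; simpl; auto|].
  rewrite Forall_forall in Ht.
  destruct (tile_corner t x) as [[a b]|] eqn:E; [|auto]. simpl.
  split; constructor; auto; intros H; apply in_map_iff in H as ((a' & b') & H & H'); simpl in H; subst;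
    apply in_star in H' as (t' & Ht' & E').
  - destruct (shared_right_side t t' x a b b') as (y & Y & Y'); simpl in *; auto.
    now apply (Ht t' Ht' y).
  - destruct (shared_left_side t t' x a a' b) as (y & Y & Y'); simpl in *; auto.
    now apply (Ht t' Ht' y).
Qed.

(** [w] is a side of some tile [t0] at [x]. Turning [w] slightly into the cone of [t0] keeps it
    strictly inside the cone of [t], so [t0 = t]; but no side of [t] lies strictly between [a] and
    [b]. *)
Lemma edge_not_inside_tile N T t (x w a b : C) :
  rhombus_tiling N T -> In w (edges T x) -> In t T -> tile_corner t x = Some (a, b) ->
  0 < det a w -> 0 < det w b -> False.
Proof.
  intros HT Hw Ht E Ha Hb. pose proof HT as (HU & _).
  apply in_edges in Hw as (t0 & c & Ht0 & E0).
  destruct (small_linear_bound (det a w) (det a c) 0 Ha) as (h & Hh & K).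
  destruct (small_linear_bound (det w b) (det c b) 0 Hb) as (h' & Hh' & K').
  set (e := Rmin h h').
  assert (He : 0 < e) by (apply Rmin_case; lra).
  specialize (K e (conj He (Rmin_l _ _))). specialize (K' e (conj He (Rmin_r _ _))).
  clearbody e.
  assert (D1 : 0 < det a (w + (e / 2)%R * c)%C).
  { replace (det a (w + (e / 2)%R * c)%C) with (det a w + e / 2 * det a c)
      by (clear; coords; ring). lra. }
  assert (D2 : 0 < det (w + (e / 2)%R * c)%C b).
  { replace (det (w + (e / 2)%R * c)%C b) with (det w b + e / 2 * det c b)
      by (clear; coords; ring). lra. }
  assert (R1 : det w (w + (e / 2)%R * c)%C = e / 2 * det w c) by (clear; coords; ring).
  assert (R2 : det (w + (e / 2)%R * c)%C c = det w c) by (clear; coords; ring).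
  assert (R3 : det c (w + (e / 2)%R * c)%C = det c w) by (clear; coords; ring).
  assert (R4 : det (w + (e / 2)%R * c)%C w = e / 2 * det c w) by (clear; coords; ring).
  assert (R5 : det w w = 0) by (clear; coords; ring).
  destruct E0 as [E0|E0]; destruct (tile_corner_frame _ _ _ _ (HU _ Ht0) E0) as (_ & _ & D).
  - assert (t0 = t).
    { apply (tiles_overlap_eq N T t0 t x w c a b (w + (e / 2)%R * c)%C); auto;
      rewrite ?R1, ?R2; nra. }
    subst t0. rewrite E in E0. inversion E0; subst. lra.
  - assert (t0 = t).
    { apply (tiles_overlap_eq N T t0 t x c w a b (w + (e / 2)%R * c)%C); auto;
      rewrite ?R3, ?R4; nra. }
    subst t0. rewrite E in E0. inversion E0; subst. lra.
Qed.

Lemma unit_parallel (a b : C) :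
  unit_vec a -> unit_vec b -> det a b = 0 -> a = b \/ a = (- b)%C.
Proof.
  destruct a as [a1 a2], b as [b1 b2]. unfold unit_vec, det, Copp; simpl. intros Ha Hb D.
  (* [s] is the scalar product: [a] equals [s] times [b], and unit length forces [s] to be 1 or
     -1. *)
  set (s := a1 * b1 + a2 * b2).
  assert (E1 : a1 = b1 * s).
  { replace (b1 * s) with (a1 * (b1 * b1 + b2 * b2) - b2 * (a1 * b2 - a2 * b1))
      by (unfold s; ring). rewrite Hb, D. ring. }
  assert (E2 : a2 = b2 * s).
  { replace (b2 * s) with (a2 * (b1 * b1 + b2 * b2) + b1 * (a1 * b2 - a2 * b1))
      by (unfold s; ring). rewrite Hb, D. ring. }
  assert (Hs : (s - 1) * (s + 1) = 0).
  { replace ((s - 1) * (s + 1)) with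
      ((b1 * s) * (b1 * s) + (b2 * s) * (b2 * s) - s * s * (b1 * b1 + b2 * b2 - 1) - 1) by ring.
    rewrite Hb, <- E1, <- E2, Ha. ring. }
  clearbody s. apply Rmult_integral in Hs as [Hs|Hs].
  - left. f_equal; nra.
  - right. f_equal; nra.
Qed.

Lemma edge_in_tile_cone N T t (x w a b : C) :
  rhombus_tiling N T -> In w (edges T x) -> In t T -> tile_corner t x = Some (a, b) ->
  0 <= det a w -> 0 <= det w b -> w = a \/ w = b.
Proof.
  intros HT Hw Ht E Ha Hb. pose proof HT as (HU & _).
  pose proof (edges_unit _ _ _ _ HT Hw) as Uw.
  destruct (tile_corner_frame _ _ _ _ (HU _ Ht) E) as (Ua & Ub & D).
  destruct Ha as [Ha|Ha]; [destruct Hb as [Hb|Hb]|].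
  - exfalso. eapply edge_not_inside_tile; eauto.
  - right. destruct (unit_parallel w b) as [|K]; auto. exfalso. subst.
    revert Ha D. clear. coords. lra.
  - left. destruct (unit_parallel a w) as [|K]; auto. exfalso. subst.
    revert Hb D. clear. coords. lra.
Qed.

Definition rot90 (w : C) : C := (- snd w, fst w).

(** The tile met by the ray bent to the left has [w] in its closed cone, so [w] is one of its sides.
    It is the right one, since a tile with left side [w] lies to the right of the ray. *)
Lemma star_left_of_edge N T (x w : C) (e0 : R) :
  rhombus_tiling N T -> In w (edges T x) -> 0 < e0 ->
  (forall e : R, 0 < e <= e0 -> in_poly N (x + e * w + e * e * rot90 w)%C) ->
  In w (map fst (star T x)).
Proof.
  intros HT Hw He0 H. pose proof HT as (HU & _).
  destruct (tile_towards N T x w (rot90 w) e0) as (t & a & b & e & Ht & E & H1 & H2 & He & H3 & H4);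
    eauto using edges_source.
  destruct (edge_in_tile_cone N T t x w a b) as [K|K]; auto.
  - subst. apply in_map_iff. exists (a, b). split; auto. apply in_star. eauto.
  - exfalso. subst b. pose proof (edges_unit _ _ _ _ HT Hw) as U.
    revert H3 He U. clear. destruct w as [w1 w2]. coords. intros. nra.
Qed.

Lemma star_right_of_edge N T (x w : C) (e0 : R) :
  rhombus_tiling N T -> In w (edges T x) -> 0 < e0 ->
  (forall e : R, 0 < e <= e0 -> in_poly N (x + e * w + e * e * - rot90 w)%C) ->
  In w (map snd (star T x)).
Proof.
  intros HT Hw He0 H. pose proof HT as (HU & _).
  destruct (tile_towards N T x w (- rot90 w)%C e0) as (t & a & b & e & Ht & E & H1 & H2 & He & H3 & H4);
    eauto using edges_source.
  destruct (edge_in_tile_cone N T t x w a b) as [K|K]; auto.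
  - exfalso. subst a. pose proof (edges_unit _ _ _ _ HT Hw) as U.
    revert H4 He U. clear. destruct w as [w1 w2]. coords. intros. nra.
  - subst. apply in_map_iff. exists (a, b). split; auto. apply in_star. eauto.
Qed.

(** Makes lengths of filtered lists usable as decreasing measures, both for the edges in a cone and
    for the vertices below a given one. *)
Lemma length_filter_lt {A : Type} (p q : A -> bool) (l : list A) (y : A) :
  (forall z, In z l -> p z = true -> q z = true) ->
  In y l -> p y = false -> q y = true ->
  (length (filter p l) < length (filter q l))%nat.
Proof.
  intros Hpq Hy Hp Hq.
  assert (L : forall l', (forall z, In z l' -> p z = true -> q z = true) ->
            (length (filter p l') <= length (filter q l'))%nat).
  { induction l' as [|z l' IH]; simpl; intros H; [lia|].
    specialize (IH (fun z' h => H z' (or_intror h))). specialize (H z (or_introl eq_refl)).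
    destruct (p z), (q z); simpl; first [lia | now specialize (H eq_refl)]. }
  induction l as [|z l IH]; [destruct Hy|].
  simpl in *. destruct Hy as [->|Hy].
  - rewrite Hp, Hq. simpl. specialize (L l (fun z' h => Hpq z' (or_intror h))). lia.
  - specialize (IH (fun z' h => Hpq z' (or_intror h)) Hy). specialize (Hpq z (or_introl eq_refl)).
    destruct (p z), (q z); simpl; first [lia | now specialize (Hpq eq_refl)].
Qed.

(** * Generic heights and the tiles between two edges *)

Definition height (m : R) (z : C) : R := fst z + m * snd z.

Lemma height_plus m a b : height m (a + b)%C = height m a + height m b.
Proof. unfold height; coords; ring. Qed.

(** Each edge direction has height zero for at most one slope [m], and only finitely many directions
    occur, so every large [m] works. *)
Lemma generic_height N T :
  rhombus_tiling N T -> exists m, forall x w, In w (edges T x) -> height m w <> 0.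
Proof.
  intros (HU & _).
  assert (K : forall w : C, unit_vec w -> exists M, forall m, M < m -> height m w <> 0).
  { intros [w1 w2] U. unfold unit_vec, height in *; simpl in *.
    destruct (Req_dec w2 0) as [->|N2].
    - exists 0. intros m _ Z. nra.
    - exists (- w1 / w2). intros m Hm Z.
      assert (m = - w1 / w2) by (apply Rmult_eq_reg_r with w2; auto; field_simplify; lra).
      lra. }
  assert (L : exists M, forall t, In t T -> forall m, M < m ->
             height m (fst (ccw_sides t)) <> 0 /\ height m (snd (ccw_sides t)) <> 0).
  { induction T as [|t T IH].
    - exists 0. intros t [].
    - destruct IH as (M & HM); [intros; apply HU; simpl; auto|].
      destruct (ccw_sides t) as [u v] eqn:E.
      destruct (ccw_sides_spec t u v (HU t (or_introl eq_refl)) E) as (Uu & Uv & _).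
      destruct (K u Uu) as (M1 & H1), (K v Uv) as (M2 & H2).
      exists (Rmax M (Rmax M1 M2)). intros t' Ht' m Hm.
      pose proof (Rmax_l M (Rmax M1 M2)). pose proof (Rmax_r M (Rmax M1 M2)).
      pose proof (Rmax_l M1 M2). pose proof (Rmax_r M1 M2).
      destruct Ht' as [<-|Ht']; [rewrite E; simpl; split; [apply H1|apply H2]; lra|].
      apply HM; auto. lra. }
  destruct L as (M & HM). exists (M + 1). intros x w Hw.
  apply in_edges in Hw as (t & c & Ht & Ec).
  destruct (HM t Ht (M + 1)) as [H1 H2]; [lra|].
  assert (Ho : forall z : C, height (M + 1) z <> 0 -> height (M + 1) (- z)%C <> 0).
  { intros z Hz Z. apply Hz. revert Z. unfold height. coords. lra. }
  destruct Ec as [Ec|Ec]; apply tile_corner_cases in Ec as (u & v & E & S); auto;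
    rewrite E in H1, H2; simpl in H1, H2;
    destruct S as [(_ & -> & ->)|[(_ & -> & ->)|[(_ & -> & ->)|(_ & -> & ->)]]]; auto.
Qed.

(** The point is the convex combination of [x], [x + w1] and [x + w2] with weights [1 - 2 e], [e]
    and [e]. *)
Lemma in_poly_two_edges N (x w1 w2 : C) (e : R) :
  0 < e <= / 2 -> in_poly N x -> in_poly N (x + w1)%C -> in_poly N (x + w2)%C ->
  in_poly N (x + e * (w1 + w2) + e * e * RtoC 0)%C.
Proof.
  intros He H0 H1 H2 k Hk. specialize (H0 k Hk). specialize (H1 k Hk). specialize (H2 k Hk).
  replace (det (side_dir N k) (vsub (x + e * (w1 + w2) + e * e * RtoC 0)%C (corner N k)))
   with ((1 - 2 * e) * det (side_dir N k) (vsub x (corner N k)) +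
         e * det (side_dir N k) (vsub (x + w1)%C (corner N k)) +
         e * det (side_dir N k) (vsub (x + w2)%C (corner N k))).
  - assert (0 <= (1 - 2 * e) * det (side_dir N k) (vsub x (corner N k))) by (apply Rmult_le_pos; lra).
    assert (0 <= e * det (side_dir N k) (vsub (x + w1)%C (corner N k))) by (apply Rmult_le_pos; lra).
    assert (0 <= e * det (side_dir N k) (vsub (x + w2)%C (corner N k))) by (apply Rmult_le_pos; lra).
    lra.
  - clear. destruct (side_dir N k), (corner N k). coords. ring.
Qed.

(* Two edges spanning an angle less than pi: the tile containing their bisector lies
   between them, so the sides of that tile split the angle. *)
Lemma tile_between_edges N T (x w1 w2 : C) :
  rhombus_tiling N T -> In w1 (edges T x) -> In w2 (edges T x) -> 0 < det w1 w2 ->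
  exists t (a b : C), In t T /\ tile_corner t x = Some (a, b) /\
    0 <= det w1 a /\ 0 < det a w2 /\ 0 < det w1 b /\ 0 <= det b w2.
Proof.
  intros HT H1 H2 D. pose proof HT as (HU & _).
  assert (P : forall w, In w (edges T x) -> in_poly N (x + w)%C).
  { intros w Hw. eapply in_poly_vertex; [eauto|]. eapply edges_source; eauto.
    eapply edges_rev; eauto. }
  pose proof (edges_source _ _ _ _ HT H1) as Vx.
  destruct (tile_towards N T x (w1 + w2)%C (RtoC 0) (/ 2)) as
    (t & a & b & e & Ht & E & Q1 & Q2 & _); auto; [lra| |].
  { intros e He. apply in_poly_two_edges; auto. eapply in_poly_vertex; eauto. }
  exists t, a, b. split; auto. split; auto.
  destruct (tile_corner_frame _ _ _ _ (HU _ Ht) E) as (Ua & Ub & Dab).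
  assert (N1 := edge_not_inside_tile N T t x w1 a b HT H1 Ht E).
  assert (N2 := edge_not_inside_tile N T t x w2 a b HT H2 Ht E).
  (* Otherwise the three-term relation between determinants places [w1] strictly inside the tile;
     likewise for [w2] in the next step. *)
  assert (A1 : 0 <= det w1 a).
  { apply Rnot_lt_le. intros Z. apply N1.
    - revert Z. clear. coords. lra.
    - assert (I : det a w1 * det (w1 + w2)%C b + det a b * det w1 w2 =
               det a (w1 + w2)%C * det w1 b) by (clear; coords; ring).
      assert (0 < det a w1) by (revert Z; clear; coords; lra). nra. }
  assert (B1 : 0 <= det b w2).
  { apply Rnot_lt_le. intros Z.
    assert (Z' : 0 < det w2 b) by (revert Z; clear; coords; lra).
    apply N2; auto.
    assert (I : det a w2 * det (w1 + w2)%C b =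
             det a (w1 + w2)%C * det w2 b + det a b * det w1 w2) by (clear; coords; ring).
    nra. }
  assert (I1 : det a (w1 + w2)%C + det w1 a = det a w2) by (clear; coords; ring).
  assert (I2 : det (w1 + w2)%C b + det b w2 = det w1 b) by (clear; coords; ring).
  assert (J1 : det w1 w2 * det a b = det a w2 * det w1 b - det w1 a * det b w2)
    by (clear; coords; ring).
  repeat split; auto; nra.
Qed.

(** * Potentials of closed edge functions *)

(** A discrete closed one-form, [psi x y] being the increment along the edge from [x] to [y]. *)
Definition closed_on_tiles (T : list rhombus) (psi : C -> C -> C) : Prop :=
  forall t (x a b : C), In t T -> tile_corner t x = Some (a, b) ->
    (psi x (x + a) + psi (x + a) (x + a + b) =
     psi x (x + b) + psi (x + b) (x + a + b))%C.

Definition in_cone (w1 w2 e : C) : bool :=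
  if Rlt_dec 0 (det w1 e) then if Rlt_dec 0 (det e w2) then true else false else false.

Lemma in_cone_true (w1 w2 e : C) :
  in_cone w1 w2 e = true <-> 0 < det w1 e /\ 0 < det e w2.
Proof.
  unfold in_cone. destruct (Rlt_dec 0 (det w1 e)), (Rlt_dec 0 (det e w2)); split; intros H;
    try tauto; discriminate.
Qed.

Lemma det_opp (a b : C) : det a b = - det b a.
Proof. unfold det; ring. Qed.

Lemma det_self (a : C) : det a a = 0.
Proof. unfold det; ring. Qed.

Lemma downward_parallel m (w1 w2 : C) :
  unit_vec w1 -> unit_vec w2 -> det w1 w2 = 0 ->
  height m w1 < 0 -> height m w2 < 0 -> w1 = w2.
Proof.
  intros U1 U2 D H1 H2. destruct (unit_parallel w1 w2 U1 U2 D) as [|E]; auto.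
  subst. revert H1 H2. unfold height. coords. lra.
Qed.

Lemma height_in_cone m (w1 w2 e : C) :
  0 < det w1 w2 -> 0 <= det w1 e -> 0 <= det e w2 ->
  0 < det w1 e \/ 0 < det e w2 ->
  height m w1 < 0 -> height m w2 < 0 -> height m e < 0.
Proof.
  intros D H1 H2 H K1 K2.
  assert (I : det w1 w2 * height m e = det e w2 * height m w1 + det w1 e * height m w2)
    by (unfold height; clear; coords; ring).
  nra.
Qed.

(* Local confluence: consecutive downward edges at [x] are compared through the tile
   that has [x] as its top vertex. *)
Lemma downward_edges_agree N T psi F m x :
  rhombus_tiling N T -> closed_on_tiles T psi ->
  (forall y w : C, height m y < height m x -> In w (edges T y) -> height m w < 0 ->
     (F (y + w) - F y = psi y (y + w))%C) ->
  forall w1 w2, In w1 (edges T x) -> In w2 (edges T x) ->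
  height m w1 < 0 -> height m w2 < 0 ->
  (F (x + w1) - psi x (x + w1) = F (x + w2) - psi x (x + w2))%C.
Proof.
  intros HT Hpsi HF. pose proof HT as (HU & _).
  (* Induction on the number of edges strictly between [w1] and [w2], along the chain [w1], [a],
     [b], [w2]. *)
  assert (K : forall n (w1 w2 : C), In w1 (edges T x) -> In w2 (edges T x) ->
    height m w1 < 0 -> height m w2 < 0 -> 0 < det w1 w2 ->
    (length (filter (in_cone w1 w2) (edges T x)) < n)%nat ->
    (F (x + w1) - psi x (x + w1) = F (x + w2) - psi x (x + w2))%C).
  { induction n as [|n IH]; [intros; lia|].
    intros w1 w2 H1 H2 D1 D2 D Hn.
    destruct (tile_between_edges N T x w1 w2 HT H1 H2 D)
      as (t & a & b & Ht & E & A1 & A2 & B1 & B2).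
    destruct (tile_corner_frame _ _ _ _ (HU _ Ht) E) as (Ua & Ub & Dab).
    assert (Ha : In a (edges T x)) by (apply in_edges; eauto).
    assert (Hb : In b (edges T x)) by (apply in_edges; eauto).
    assert (Da : height m a < 0) by (apply (height_in_cone m w1 w2); auto; lra).
    assert (Db : height m b < 0) by (apply (height_in_cone m w1 w2); auto; lra).
    transitivity (F (x + a) - psi x (x + a))%C; [|transitivity (F (x + b) - psi x (x + b))%C].
    - destruct A1 as [A1|A1].
      + apply IH; auto. eapply Nat.lt_le_trans; [|apply Nat.lt_succ_r, Hn].
        (* The open cone from [w1] to [a] lies in that from [w1] to [w2] but no longer contains
           [a]. *)
        apply length_filter_lt with (y := a); auto.
        * intros e _ He. apply in_cone_true in He as [He1 He2]. apply in_cone_true.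
          split; auto.
          assert (I : det w1 w2 * det e a = det a w2 * det e w1 + det w1 a * det e w2)
            by (clear; coords; ring).
          rewrite (det_opp e w1) in I. nra.
        * unfold in_cone. rewrite det_self.
          destruct (Rlt_dec 0 _); auto. destruct (Rlt_dec 0 0); auto. lra.
        * apply in_cone_true; auto.
      + rewrite (downward_parallel m w1 a); auto. eapply edges_unit; eauto.
    (* Both ways down the tile end at [x + a + b]. Their lower edges start below [x], where [F] is
       already right, and closedness then compares the upper ones. *)
    - assert (E1 : (F (x + a + b) - F (x + a) = psi (x + a) (x + a + b))%C).
      { apply HF; auto.
        - rewrite height_plus. lra.
        - apply in_edges. exists t, (- a)%C. split; auto. left. apply tile_corner_next; auto. }
      assert (E2 : (F (x + b + a) - F (x + b) = psi (x + b) (x + b + a))%C).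
      { apply HF; auto.
        - rewrite height_plus. lra.
        - apply in_edges. exists t, (- b)%C. split; auto. right. apply tile_corner_prev; auto. }
      pose proof (Hpsi t x a b Ht E) as E3.
      replace (x + b + a)%C with (x + a + b)%C in E2 by ring.
      rewrite <- E1, <- E2 in E3.
      replace (psi x (x + a)%C) with
        (psi x (x + b) + (F (x + a + b) - F (x + b)) - (F (x + a + b) - F (x + a)))%C.
      + ring.
      + rewrite <- E3. ring.
    - destruct B2 as [B2|B2].
      + apply IH; auto. eapply Nat.lt_le_trans; [|apply Nat.lt_succ_r, Hn].
        apply length_filter_lt with (y := b); auto.
        * intros e _ He. apply in_cone_true in He as [He1 He2]. apply in_cone_true.
          split; auto.
          assert (I : det w1 w2 * det b e = det b w2 * det w1 e + det w1 b * det w2 e)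
            by (clear; coords; ring).
          rewrite (det_opp w2 e) in I. nra.
        * unfold in_cone. rewrite det_self. destruct (Rlt_dec 0 0); auto. lra.
        * apply in_cone_true; auto.
      + rewrite (downward_parallel m b w2); auto. eapply edges_unit; eauto. }
  intros w1 w2 H1 H2 D1 D2.
  destruct (Rtotal_order 0 (det w1 w2)) as [D|[D|D]].
  - eapply K; eauto.
  - rewrite (downward_parallel m w1 w2); auto; eapply edges_unit; eauto.
  - symmetry. eapply K; eauto. rewrite det_opp. lra.
Qed.

(** Recursion on the number of lower vertices: the value at a new vertex is read off along one
    chosen downward edge, and local confluence makes the choice immaterial. *)
Theorem edge_potential N T psi :
  rhombus_tiling N T ->
  (forall x y, psi y x = - psi x y)%C -> closed_on_tiles T psi ->
  exists F : C -> C, forall x w, In w (edges T x) -> (F (x + w) - F x = psi x (x + w))%C.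
Proof.
  intros HT Hanti Hpsi.
  destruct (generic_height N T HT) as [m Hm].
  set (vs := flat_map (fun t => verts t : list C) T).
  assert (Hvs : forall x : C, is_vertex T x -> In x vs).
  { intros x (t & Ht & Hx). apply in_flat_map. eauto. }
  set (lower := fun x y : C => if Rlt_dec (height m y) (height m x) then true else false).
  set (rank := fun x : C => length (filter (lower x) vs)).
  assert (Hrank : forall x y : C, is_vertex T y -> height m y < height m x ->
            (rank y < rank x)%nat).
  { intros x y Hy Hlt. apply length_filter_lt with (y := y); auto.
    - intros z _. unfold lower. destruct (Rlt_dec _ _), (Rlt_dec _ _); auto; lra.
    - unfold lower. destruct (Rlt_dec _ _); auto; lra.
    - unfold lower. destruct (Rlt_dec _ _); auto; lra. }
  (* At stage [n] the equation holds on downward edges from vertices of rank below [n]; the next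
     stage keeps the values there. *)
  assert (K : forall n, exists F : C -> C, forall x w, (rank x < n)%nat ->
     In w (edges T x) -> height m w < 0 -> (F (x + w) - F x = psi x (x + w))%C).
  { induction n as [|n [F HF]]; [exists (fun x => x); intros; lia|].
    set (next := fun x : C => epsilon (inhabits x)
           (fun w => In w (edges T x) /\ height m w < 0)).
    exists (fun x => if lt_dec (rank x) n then F x else F (x + next x) - psi x (x + next x))%C.
    intros x w Hx Hw Dw.
    assert (Hxw : is_vertex T (x + w)%C).
    { eapply edges_source; eauto. eapply edges_rev; eauto. }
    assert (Hlow : (rank (x + w)%C < rank x)%nat).
    { apply Hrank; auto. rewrite height_plus. lra. }
    destruct (lt_dec (rank (x + w)%C) n) as [_|]; [|lia].
    destruct (lt_dec (rank x) n) as [Hn|Hn]; [auto|].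
    assert (Hnext : In (next x) (edges T x) /\ height m (next x) < 0).
    { unfold next. apply epsilon_spec. eauto. }
    destruct Hnext as [N1 N2].
    rewrite <- (downward_edges_agree N T psi F m x HT Hpsi) with (w1 := w); auto.
    - ring.
    - intros y w' Hy Hw' Dw'. apply HF; auto.
      assert (rank y < rank x)%nat by (apply Hrank; auto; eapply edges_source; eauto). lia. }
  destruct (K (S (length vs))) as [F HF]. exists F. intros x w Hw.
  assert (Hr : forall y, (rank y < S (length vs))%nat).
  { intros y. apply Nat.lt_succ_r. apply filter_length_le. }
  (* Downward edges are covered, horizontal ones do not exist, and upward ones follow by reversal
     and antisymmetry. *)
  destruct (Rtotal_order (height m w) 0) as [D|[D|D]].
  - apply HF; auto.
  - exfalso. eapply Hm; eauto.
  - assert (E : (F (x + w + - w) - F (x + w) = psi (x + w) (x + w + - w))%C).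
    { apply HF; auto.
      - eapply edges_rev; eauto.
      - revert D. unfold height. clear. coords. lra. }
    rewrite Cplus_opp_cancel in E. rewrite Hanti, <- E. ring.
Qed.

(** * The regular polygon *)

Definition cis (x : R) : C := (cos x, sin x).

Definition angle (N : nat) : R := PI / INR N.

Lemma side_dir_cis N k : side_dir N k = cis (INR k * angle N).
Proof. unfold side_dir, cis, angle, Rdiv. now rewrite Rmult_assoc. Qed.

Lemma angle_spec N : (1 <= N)%nat -> INR N * angle N = PI.
Proof.
  intros H. unfold angle. field. apply not_0_INR. lia.
Qed.

Lemma angle_pos N : (1 <= N)%nat -> 0 < angle N.
Proof.
  intros H. apply Rdiv_lt_0_compat; [apply PI_RGT_0|]. apply lt_0_INR. lia.
Qed.

Lemma sin_fraction_pos N r :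
  (1 <= N)%nat -> (0 < r < 2 * N)%nat -> 0 < sin (INR r * angle N / 2).
Proof.
  intros HN Hr. pose proof (angle_pos N HN). pose proof (angle_spec N HN).
  assert (INR r < 2 * INR N) by (change 2 with (INR 2); rewrite <- mult_INR; apply lt_INR; lia).
  assert (0 < INR r) by (apply lt_0_INR; lia). apply sin_gt_0; nra.
Qed.

Lemma sin_half_angle_pos N : (1 <= N)%nat -> 0 < sin (angle N / 2).
Proof.
  intros HN. replace (angle N / 2) with (INR 1 * angle N / 2) by (simpl; field).
  apply sin_fraction_pos; lia.
Qed.

Lemma sin_angle_pos N : (2 <= N)%nat -> 0 < sin (angle N).
Proof.
  intros HN. replace (angle N) with (INR 2 * angle N / 2) by (simpl; field).
  apply sin_fraction_pos; lia.
Qed.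

(** A telescoping sum of cosines; the factor [2 * sin (angle N / 2)] stays on the left to avoid
    division. The next lemma treats the sines alike. *)
Lemma corner_fst N k : (1 <= N)%nat ->
  2 * sin (angle N / 2) * fst (corner N k) =
  sin (INR k * angle N - angle N / 2) + sin (angle N / 2).
Proof.
  intros HN. induction k as [|k IH].
  - simpl. rewrite Rmult_0_l, Rminus_0_l, sin_neg. ring.
  - rewrite S_INR. cbn [corner]. rewrite side_dir_cis. unfold vadd, cis. cbn [fst].
    rewrite Rmult_plus_distr_l, IH.
    replace ((INR k + 1) * angle N - angle N / 2) with (INR k * angle N + angle N / 2) by field.
    rewrite sin_plus, sin_minus. ring.
Qed.

Lemma corner_snd N k : (1 <= N)%nat ->
  2 * sin (angle N / 2) * snd (corner N k) =
  cos (angle N / 2) - cos (INR k * angle N - angle N / 2).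
Proof.
  intros HN. induction k as [|k IH].
  - simpl. rewrite Rmult_0_l, Rminus_0_l, cos_neg. ring.
  - rewrite S_INR. cbn [corner]. rewrite side_dir_cis. unfold vadd, cis. cbn [snd].
    rewrite Rmult_plus_distr_l, IH.
    replace ((INR k + 1) * angle N - angle N / 2) with (INR k * angle N + angle N / 2) by field.
    rewrite cos_plus, cos_minus. ring.
Qed.

Lemma angle_period N k q : (1 <= N)%nat ->
  INR (k + 2 * N * q) * angle N = INR k * angle N + 2 * INR q * PI.
Proof.
  intros HN. rewrite plus_INR, !mult_INR, <- (angle_spec N HN). simpl. ring.
Qed.

Lemma side_dir_period N k q : (1 <= N)%nat -> side_dir N (k + 2 * N * q) = side_dir N k.
Proof.
  intros HN. rewrite !side_dir_cis, angle_period by auto. unfold cis.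
  now rewrite cos_period, sin_period.
Qed.

Lemma corner_period N k q : (1 <= N)%nat -> corner N (k + 2 * N * q) = corner N k.
Proof.
  intros HN. pose proof (sin_half_angle_pos N HN).
  apply injective_projections; apply Rmult_eq_reg_l with (2 * sin (angle N / 2)); try lra.
  - rewrite !corner_fst by auto. f_equal. rewrite angle_period by auto.
    rewrite <- (sin_period (INR k * angle N - angle N / 2) q). f_equal. ring.
  - rewrite !corner_snd by auto. f_equal. rewrite angle_period by auto.
    rewrite <- (cos_period (INR k * angle N - angle N / 2) q). f_equal. ring.
Qed.

(** Congruence modulo [2 * N] is expressed by adding multiples on both sides, which avoids truncated
    subtraction. *)
Lemma corner_congr N j k q q' : (1 <= N)%nat ->
  (j + 2 * N * q = k + 2 * N * q')%nat ->
  corner N j = corner N k /\ side_dir N j = side_dir N k.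
Proof.
  intros HN E. split.
  - rewrite <- (corner_period N j q HN), E. now apply corner_period.
  - rewrite <- (side_dir_period N j q HN), E. now apply side_dir_period.
Qed.

Lemma corner_offset N j k : (1 <= N)%nat ->
  exists r q q', (r < 2 * N)%nat /\ (j + 2 * N * q = k + r + 2 * N * q')%nat.
Proof.
  intros HN. exists ((j + 2 * N * k - k) mod (2 * N))%nat, k, ((j + 2 * N * k - k) / (2 * N))%nat.
  pose proof (Nat.div_mod (j + 2 * N * k - k) (2 * N)).
  split; [apply Nat.mod_upper_bound; lia|nia].
Qed.

Lemma corner_succ_minus N k : (corner N (S k) - corner N k)%C = side_dir N k.
Proof. cbn [corner]. destruct (corner N k), (side_dir N k). coords. f_equal; ring. Qed.

(** Up to the factor in front, the distance of a corner from the line of side [k]. The product form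
    exhibits its sign and its zeros at [r = 0] and [r = 1]. *)
Lemma det_side_corner N k r : (1 <= N)%nat ->
  sin (angle N / 2) * det (side_dir N k) (vsub (corner N (k + r)) (corner N k)) =
  sin (INR r * angle N / 2) * sin (INR r * angle N / 2 - angle N / 2).
Proof.
  intros HN. apply Rmult_eq_reg_l with 2; [|lra].
  set (al := INR k * angle N). set (h := angle N / 2). set (ro := INR r * angle N / 2).
  replace (2 * (sin h * det (side_dir N k) (vsub (corner N (k + r)) (corner N k)))) with
   (cos al * (2 * sin h * snd (corner N (k + r)) - 2 * sin h * snd (corner N k)) -
    sin al * (2 * sin h * fst (corner N (k + r)) - 2 * sin h * fst (corner N k))).
  2: { rewrite side_dir_cis. unfold det, vsub, cis, al; simpl. ring. }
  unfold h. rewrite !corner_fst, !corner_snd by auto. fold h.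
  rewrite plus_INR.
  replace ((INR k + INR r) * angle N - h) with (al + (2 * ro - h)) by (unfold al, ro, h; field).
  fold al.
  transitivity (cos h - cos (2 * ro - h)).
  - pose proof (sin2_cos2 al) as P. unfold Rsqr in P.
    rewrite cos_plus, sin_plus, (cos_minus al h), (sin_minus al h).
    transitivity ((cos h - cos (2 * ro - h)) * (sin al * sin al + cos al * cos al)); [ring|].
    rewrite P. ring.
  - rewrite form2. replace ((h - (2 * ro - h)) / 2) with (- (ro - h)) by field.
    replace ((h + (2 * ro - h)) / 2) with ro by field. rewrite sin_neg. ring.
Qed.

Lemma det_side_corner_sign N k j : (1 <= N)%nat ->
  0 <= det (side_dir N k) (vsub (corner N j) (corner N k)) /\
  (det (side_dir N k) (vsub (corner N j) (corner N k)) = 0 ->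
   exists q q', (j + 2 * N * q = k + 2 * N * q' \/ j + 2 * N * q = S k + 2 * N * q')%nat).
Proof.
  intros HN. destruct (corner_offset N j k HN) as (r & q & q' & Hr & E).
  destruct (corner_congr N j (k + r) q q' HN E) as [-> _].
  pose proof (det_side_corner N k r HN) as F. pose proof (sin_half_angle_pos N HN) as P.
  assert (K : r = 0%nat \/ r = 1%nat \/ 0 < sin (INR r * angle N / 2 - angle N / 2) /\
              0 < sin (INR r * angle N / 2)).
  { destruct (Nat.eq_dec r 0) as [|N0]; auto. destruct (Nat.eq_dec r 1) as [|N1]; auto.
    right; right. split; [|apply sin_fraction_pos; lia].
    replace (INR r * angle N / 2 - angle N / 2) with (INR (r - 1) * angle N / 2).
    - apply sin_fraction_pos; lia.
    - rewrite minus_INR by lia. simpl. field. }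
  destruct K as [->|[->|[K1 K2]]].
  - rewrite (Rmult_comm _ (det _ _)) in F.
    replace (INR 0 * angle N / 2) with 0 in F by (simpl; field).
    rewrite sin_0, Rmult_0_l in F. split; [nra|]. intros _. exists q, q'. lia.
  - replace (INR 1 * angle N / 2 - angle N / 2) with 0 in F by (simpl; field).
    rewrite sin_0, Rmult_0_r in F. split; [nra|]. intros _. exists q, q'. lia.
  - assert (0 < sin (angle N / 2) * det (side_dir N k) (vsub (corner N (k + r)) (corner N k)))
      by (rewrite F; nra).
    split; [nra|]. intros Z. rewrite Z in H. lra.
Qed.

Lemma in_poly_corner N j : (1 <= N)%nat -> in_poly N (corner N j).
Proof. intros HN k _. now apply det_side_corner_sign. Qed.

Lemma in_poly_all N x k : (1 <= N)%nat -> in_poly N x ->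
  0 <= det (side_dir N k) (vsub x (corner N k)).
Proof.
  intros HN H. pose proof (Nat.div_mod k (2 * N)).
  destruct (corner_congr N k (k mod (2 * N)) 0 (k / (2 * N)) HN) as [-> ->]; [lia|].
  apply H. apply Nat.mod_upper_bound. lia.
Qed.

Lemma det_consecutive_sides N k :
  det (side_dir N k) (side_dir N (S k)) = sin (angle N).
Proof.
  rewrite !side_dir_cis, S_INR. unfold det, cis; simpl.
  replace (angle N) with ((INR k + 1) * angle N - INR k * angle N) at 5 by ring.
  rewrite sin_minus. ring.
Qed.

Lemma side_dir_unit N k : unit_vec (side_dir N k).
Proof.
  rewrite side_dir_cis. unfold unit_vec, cis; simpl.
  pose proof (sin2_cos2 (INR k * angle N)) as H. unfold Rsqr in H. lra.
Qed.

(** * Vertices and edges on the boundary of the polygon *)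

Lemma in_poly_segment N (x y : C) (s : R) : 0 <= s <= 1 ->
  in_poly N x -> in_poly N y -> in_poly N (x + s * (y - x))%C.
Proof.
  intros Hs Hx Hy k Hk. specialize (Hx k Hk). specialize (Hy k Hk).
  replace (det (side_dir N k) (vsub (x + s * (y - x))%C (corner N k)))
   with ((1 - s) * det (side_dir N k) (vsub x (corner N k)) +
         s * det (side_dir N k) (vsub y (corner N k))).
  - assert (0 <= (1 - s) * det (side_dir N k) (vsub x (corner N k))) by (apply Rmult_le_pos; lra).
    assert (0 <= s * det (side_dir N k) (vsub y (corner N k))) by (apply Rmult_le_pos; lra).
    lra.
  - clear. destruct (side_dir N k), (corner N k). coords. ring.
Qed.

Lemma det_edge_at_side N T (x w : C) k :
  (1 <= N)%nat -> rhombus_tiling N T -> In w (edges T x) ->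
  det (side_dir N k) (vsub x (corner N k)) = 0 -> 0 <= det (side_dir N k) w.
Proof.
  intros HN HT Hw H0.
  assert (H : in_poly N (x + w)%C).
  { eapply in_poly_vertex; [eauto|]. eapply edges_source; [eauto|]. eapply edges_rev; eauto. }
  apply (in_poly_all N _ k HN) in H.
  replace (det (side_dir N k) w) with
    (det (side_dir N k) (vsub (x + w)%C (corner N k)) - det (side_dir N k) (vsub x (corner N k))).
  - lra.
  - clear. destruct (side_dir N k), (corner N k). coords. ring.
Qed.

(** The tile met when moving along the side has a right side [a] that neither leaves the polygon nor
    lies to the left of the side, so [a] is parallel to it. *)
Lemma side_edge_at_vertex N T (x : C) k e0 :
  (1 <= N)%nat -> rhombus_tiling N T -> is_vertex T x ->
  det (side_dir N k) (vsub x (corner N k)) = 0 -> 0 < e0 ->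
  (forall e : R, 0 < e <= e0 -> in_poly N (x + e * side_dir N k)%C) ->
  In (side_dir N k : C) (edges T x).
Proof.
  intros HN HT Hx H0 He0 H. pose proof HT as (HU & _).
  destruct (tile_towards N T x (side_dir N k) (RtoC 0) e0) as
    (t & a & b & e & Ht & E & Q1 & Q2 & _); auto.
  { intros e He. replace (x + e * side_dir N k + e * e * RtoC 0)%C with (x + e * side_dir N k)%C
      by (destruct (side_dir N k); coords; f_equal; ring). auto. }
  assert (Ha : In a (edges T x)) by (apply in_edges; eauto).
  pose proof (det_edge_at_side N T x a k HN HT Ha H0) as D.
  destruct (tile_corner_frame _ _ _ _ (HU _ Ht) E) as (Ua & Ub & Dab).
  destruct (unit_parallel a (side_dir N k)) as [K|K]; auto.
  - apply side_dir_unit.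
  - pose proof (det_opp a (side_dir N k)). lra.
  - now rewrite <- K.
  - exfalso. rewrite K in Dab. revert Dab Q1. clear. destruct (side_dir N k). coords. lra.
Qed.

Lemma corner_S N k : corner N (S k) = (corner N k + side_dir N k)%C.
Proof. reflexivity. Qed.

(** Gives every corner a preceding side: corner 0 is also corner [2 * N]. *)
Lemma corner_as_succ N k : (1 <= N)%nat ->
  exists j, corner N k = corner N (S j) /\ side_dir N k = side_dir N (S j).
Proof.
  intros HN. exists (k + 2 * N - 1)%nat.
  apply (corner_congr N k (S (k + 2 * N - 1)) 1 0); auto. nia.
Qed.

(** A corner is an extreme point: a segment centred there would have to be parallel to both adjacent
    sides, which are independent. *)
Lemma corner_extreme N k (u : C) (e : R) :
  (2 <= N)%nat -> 0 < e ->
  in_poly N (corner N (S k) + e * u)%C -> in_poly N (corner N (S k) - e * u)%C ->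
  ~ unit_vec u.
Proof.
  intros HN He H1 H2 U.
  pose proof (in_poly_all N _ k ltac:(lia) H1) as P1.
  pose proof (in_poly_all N _ k ltac:(lia) H2) as P2.
  pose proof (in_poly_all N _ (S k) ltac:(lia) H1) as P3.
  pose proof (in_poly_all N _ (S k) ltac:(lia) H2) as P4.
  rewrite corner_S in *.
  pose proof (det_consecutive_sides N k) as D. pose proof (sin_angle_pos N HN) as S0.
  rewrite <- D in S0. clear D H1 H2.
  assert (Z1 : det (side_dir N k) u = 0).
  { apply Rmult_eq_reg_l with e; [|lra]. clear P3 P4 S0.
    destruct (side_dir N k), (corner N k); coords; nra. }
  assert (Z2 : det (side_dir N (S k)) u = 0).
  { apply Rmult_eq_reg_l with e; [|lra]. clear P1 P2 S0 Z1.
    destruct (side_dir N k), (side_dir N (S k)), (corner N k); coords; nra. }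
  revert Z1 Z2 S0 U. clear. destruct (side_dir N k) as [a b], (side_dir N (S k)) as [c d], u as [r r0].
  coords. intros Z1 Z2 S0 U.
  assert (E1 : (a * d - b * c) * r = 0).
  { replace ((a * d - b * c) * r) with (c * (a * r0 - b * r) - a * (c * r0 - d * r)) by ring.
    rewrite Z1, Z2; ring. }
  assert (E2 : (a * d - b * c) * r0 = 0).
  { replace ((a * d - b * c) * r0) with (d * (a * r0 - b * r) - b * (c * r0 - d * r)) by ring.
    rewrite Z1, Z2; ring. }
  assert (r = 0) by (apply Rmult_integral in E1 as [?|?]; lra).
  assert (r0 = 0) by (apply Rmult_integral in E2 as [?|?]; lra).
  subst. lra.
Qed.

(** The corner lies in some tile. A tile coordinate strictly between 0 and 1 would make it the
    midpoint of a segment in the polygon, so both coordinates are 0 or 1. *)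
Lemma corner_vertex N T k :
  (2 <= N)%nat -> rhombus_tiling N T -> is_vertex T (corner N k).
Proof.
  intros HN HT. destruct (corner_as_succ N k) as (j & -> & _); [lia|].
  pose proof HT as (HU & HC & _).
  pose proof (in_poly_corner N (S j) ltac:(lia)) as H. apply HC in H as (t & Ht & Q).
  exists t. split; auto. destruct Q as (s & w & Hs & Hw & Q).
  destruct (HU t Ht) as (U & V & _). apply vnorm_unit in U, V.
  assert (P : forall s' w', 0 <= s' <= 1 -> 0 <= w' <= 1 ->
     in_poly N (vadd (rb t) (vadd (vscale s' (ru t)) (vscale w' (rv t))))).
  { intros s' w' Hs' Hw'. apply HC. exists t. split; auto. exists s', w'. auto. }
  assert (Es : s = 0 \/ s = 1).
  { destruct (Req_dec s 0) as [|N0]; auto. destruct (Req_dec s 1) as [|N1]; auto.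
    exfalso. set (e := Rmin s (1 - s)).
    assert (0 < e) by (apply Rmin_case; lra).
    pose proof (Rmin_l s (1 - s)) as L1. pose proof (Rmin_r s (1 - s)) as L2.
    fold e in L1, L2.
    apply (corner_extreme N j (ru t) e HN); auto; rewrite Q.
    - replace (_ + _)%C with (vadd (rb t) (vadd (vscale (s + e) (ru t)) (vscale w (rv t)))).
      + apply P; lra.
      + clear. clearbody e. destruct t as [p u v]. coords. f_equal; ring.
    - replace (_ - _)%C with (vadd (rb t) (vadd (vscale (s - e) (ru t)) (vscale w (rv t)))).
      + apply P; lra.
      + clear. clearbody e. destruct t as [p u v]. coords. f_equal; ring. }
  assert (Ew : w = 0 \/ w = 1).
  { destruct (Req_dec w 0) as [|N0]; auto. destruct (Req_dec w 1) as [|N1]; auto.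
    exfalso. set (e := Rmin w (1 - w)).
    assert (0 < e) by (apply Rmin_case; lra).
    pose proof (Rmin_l w (1 - w)) as L1. pose proof (Rmin_r w (1 - w)) as L2.
    fold e in L1, L2.
    apply (corner_extreme N j (rv t) e HN); auto; rewrite Q.
    - replace (_ + _)%C with (vadd (rb t) (vadd (vscale s (ru t)) (vscale (w + e) (rv t)))).
      + apply P; lra.
      + clear. clearbody e. destruct t as [p u v]. coords. f_equal; ring.
    - replace (_ - _)%C with (vadd (rb t) (vadd (vscale s (ru t)) (vscale (w - e) (rv t)))).
      + apply P; lra.
      + clear. clearbody e. destruct t as [p u v]. coords. f_equal; ring. }
  rewrite Q. unfold verts, rA, rB, rC, rD.
  destruct t as [[p1 p2] [u1 u2] [v1 v2]]. unfold vadd, vscale. simpl.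
  destruct Es as [->| ->], Ew as [->| ->];
    [left|right; right; right; left|right; left|right; right; left]; f_equal; ring.
Qed.

Lemma side_is_edge N T k :
  (2 <= N)%nat -> rhombus_tiling N T -> In (side_dir N k : C) (edges T (corner N k)).
Proof.
  intros HN HT. apply (side_edge_at_vertex N T (corner N k) k 1); auto; try lia; try lra.
  - now apply corner_vertex.
  - clear. destruct (side_dir N k), (corner N k). coords. ring.
  - intros e He. rewrite <- corner_succ_minus. apply in_poly_segment; [lra| |];
      apply in_poly_corner; lia.
Qed.

(** Sides and edges both have length 1. A vertex at position [a < 1] along the side has an edge
    along the side, ending at position [a + 1]; staying within the side forces [a = 0]. *)
Lemma boundary_vertex_corner N T (x : C) k :
  (2 <= N)%nat -> rhombus_tiling N T -> is_vertex T x ->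
  det (side_dir N k) (vsub x (corner N k)) = 0 ->
  x = corner N k \/ x = corner N (S k).
Proof.
  intros HN HT Hx H0. assert (HN1 : (1 <= N)%nat) by lia.
  set (s := side_dir N k : C) in *.
  assert (Us : unit_vec s) by apply side_dir_unit.
  assert (Y : forall y : C, det s (vsub y (corner N k)) = 0 ->
     exists a : R, y = (corner N k + a * s)%C).
  { intros y Hy. exists (fst s * (fst y - fst (corner N k)) + snd s * (snd y - snd (corner N k))).
    revert Hy Us. clear. clearbody s.
    destruct s as [s1 s2], (corner N k) as [c1 c2], y as [y1 y2]. coords. intros Hy Us.
    f_equal.
    - replace y1 with (c1 + (y1 - c1) * (s1 * s1 + s2 * s2)) at 1 by (rewrite Us; ring).
      replace ((y1 - c1) * (s1 * s1 + s2 * s2)) with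
        (s1 * (s1 * (y1 - c1) + s2 * (y2 - c2)) - s2 * (s1 * (y2 - c2) - s2 * (y1 - c1))) by ring.
      rewrite Hy. ring.
    - replace y2 with (c2 + (y2 - c2) * (s1 * s1 + s2 * s2)) at 1 by (rewrite Us; ring).
      replace ((y2 - c2) * (s1 * s1 + s2 * s2)) with
        (s2 * (s1 * (y1 - c1) + s2 * (y2 - c2)) + s1 * (s1 * (y2 - c2) - s2 * (y1 - c1))) by ring.
      rewrite Hy. ring. }
  (* The half-planes of the preceding and the following side bound the position along side [k]. *)
  assert (B : forall a : R, in_poly N (corner N k + a * s)%C -> 0 <= a <= 1).
  { intros a Ha. split.
    - destruct (corner_as_succ N k HN1) as (j & Ec & Es).
      pose proof (in_poly_all N _ j HN1 Ha) as P.
      pose proof (det_consecutive_sides N j) as D. pose proof (sin_angle_pos N HN) as S0.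
      rewrite Ec, corner_S in P. unfold s in P. rewrite Es in P.
      replace (det _ _) with (a * sin (angle N)) in P; [nra|].
      rewrite <- D. clear. destruct (side_dir N j), (side_dir N (S j)), (corner N j). coords. ring.
    - pose proof (in_poly_all N _ (S k) HN1 Ha) as P.
      pose proof (det_consecutive_sides N k) as D. pose proof (sin_angle_pos N HN) as S0.
      rewrite corner_S in P. unfold s in P.
      replace (det _ _) with ((1 - a) * sin (angle N)) in P; [nra|].
      rewrite <- D. clear. destruct (side_dir N k), (side_dir N (S k)), (corner N k). coords. ring. }
  destruct (Y x H0) as (a & Ea).
  pose proof (in_poly_vertex N T x HT Hx) as Px. rewrite Ea in Px. pose proof (B a Px) as Ba.
  destruct (Req_dec a 1) as [->|Na].
  { right. rewrite Ea, corner_S. fold s. destruct s, (corner N k). coords. f_equal; ring. }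
  left.
  assert (Hs : In s (edges T x)).
  { apply (side_edge_at_vertex N T x k (1 - a)); auto; [lra|].
    intros e He. fold s. rewrite Ea.
    replace (corner N k + a * s + e * s)%C with
      (corner N k + (a + e)%R * (corner N (S k) - corner N k))%C.
    - apply in_poly_segment; [lra| |]; now apply in_poly_corner.
    - rewrite corner_succ_minus. fold s. clear. clearbody s.
      destruct (corner N k). coords. f_equal; ring. }
  apply (edges_rev N T) in Hs; auto. apply (edges_source N T) in Hs; auto.
  apply (in_poly_vertex N T) in Hs; auto. rewrite Ea in Hs.
  replace (corner N k + a * s + s)%C with (corner N k + (a + 1)%R * s)%C in Hs.
  - apply B in Hs. assert (a = 0) by lra. subst a. rewrite Ea.
    destruct s, (corner N k). coords. f_equal; ring.
  - clear. clearbody s. destruct (corner N k). coords. f_equal; ring.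
Qed.

(** * Matching the sides of tiles at interior vertices and at corners *)

Lemma eventually_in_poly N (x w p : C) :
  (forall k, (k < 2 * N)%nat ->
    0 <= det (side_dir N k) (vsub x (corner N k)) /\
    (det (side_dir N k) (vsub x (corner N k)) = 0 ->
       0 <= det (side_dir N k) w /\ (det (side_dir N k) w = 0 -> 0 <= det (side_dir N k) p))) ->
  exists e0, 0 < e0 /\ forall e : R, 0 < e <= e0 -> in_poly N (x + e * w + e * e * p)%C.
Proof.
  intros H.
  destruct (eventually_forall_lt (fun k e => 0 <= det (side_dir N k) (vsub x (corner N k)) +
     e * (det (side_dir N k) w + e * det (side_dir N k) p)) (2 * N)) as (h & Hh & K).
  { intros k Hk. destruct (H k Hk) as [H1 H2]. apply eventually_quadratic_nonneg; tauto. }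
  exists h. split; auto. intros e He k Hk. specialize (K e He k Hk). cbv beta in K.
  revert K. clear. destruct (side_dir N k), (corner N k). coords. lra.
Qed.

(** At an interior vertex every edge has a tile on either side, so right sides and left sides are
    the same edges. *)
Lemma star_interior N T (x : C) :
  (2 <= N)%nat -> rhombus_tiling N T -> is_vertex T x -> ~ on_bdry N x ->
  Permutation (map fst (star T x)) (map snd (star T x)).
Proof.
  intros HN HT Hx Hb. destruct (star_sides_NoDup N T x HT) as [N1 N2].
  pose proof (in_poly_vertex N T x HT Hx) as Px.
  assert (I : forall p w, exists e0, 0 < e0 /\
             forall e : R, 0 < e <= e0 -> in_poly N (x + e * w + e * e * p)%C).
  { intros p w. apply eventually_in_poly. intros k Hk. split; [now apply Px|].
    intros Z. exfalso. apply Hb. split; eauto. }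
  apply NoDup_Permutation; auto. intros w. split; intros Hw.
  - destruct (I (- rot90 w)%C w) as (e0 & He0 & K).
    eapply star_right_of_edge; eauto. unfold edges. apply in_app_iff; auto.
  - destruct (I (rot90 w)%C w) as (e0 & He0 & K).
    eapply star_left_of_edge; eauto. unfold edges. apply in_app_iff; auto.
Qed.

Lemma det_opp_r (a b : C) : det a (- b)%C = - det a b.
Proof. coords; ring. Qed.

Lemma det_opp_l (a b : C) : det (- a)%C b = - det a b.
Proof. coords; ring. Qed.

Lemma det_rot90 (a : C) : unit_vec a -> det a (rot90 a) = 1.
Proof. unfold rot90. coords. lra. Qed.

(** The two polygon sides at a corner border the tiles on one side only: the outgoing one is only a
    right side, the reversed incoming one only a left side. Adding each to the list where it is
    missing restores the matching. *)
Lemma star_corner N T k :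
  (2 <= N)%nat -> rhombus_tiling N T ->
  Permutation ((- side_dir N k)%C :: map fst (star T (corner N (S k))))
    ((side_dir N (S k) : C) :: map snd (star T (corner N (S k)))).
Proof.
  intros HN HT. assert (HN1 : (1 <= N)%nat) by lia.
  set (x := corner N (S k) : C). set (a := side_dir N (S k) : C). set (s := side_dir N k : C).
  destruct (star_sides_NoDup N T x HT) as [N1 N2]. pose proof HT as (HU & _).
  assert (Us : unit_vec s) by apply side_dir_unit.
  assert (Ua : unit_vec a) by apply side_dir_unit.
  assert (Dsa : 0 < det s a).
  { unfold s, a. rewrite det_consecutive_sides. now apply sin_angle_pos. }
  assert (Es : forall w, In w (edges T x) -> 0 <= det s w).
  { intros w Hw. apply (det_edge_at_side N T x w k); auto.
    unfold x. rewrite corner_S. clear. destruct (corner N k), (side_dir N k). coords. ring. }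
  assert (Ea : forall w, In w (edges T x) -> 0 <= det a w).
  { intros w Hw. apply (det_edge_at_side N T x w (S k)); auto.
    unfold x. clear. destruct (corner N (S k)), (side_dir N (S k)). coords. ring. }
  assert (Ha : In a (edges T x)) by now apply side_is_edge.
  assert (Hs : In (- s)%C (edges T x)).
  { unfold x. rewrite corner_S. eapply edges_rev; eauto. now apply side_is_edge. }
  (* The bending [p] is constrained only when [w] runs along one of the two polygon sides. *)
  assert (I : forall w p : C, In w (edges T x) ->
     (w = a -> 0 <= det a p) -> (w = (- s)%C -> 0 <= det s p) ->
     exists e0, 0 < e0 /\ forall e : R, 0 < e <= e0 -> in_poly N (x + e * w + e * e * p)%C).
  { intros w p Hw H1 H2. apply eventually_in_poly. intros j Hj.
    destruct (det_side_corner_sign N j (S k) HN1) as [P Q]. split; [exact P|].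
    intros Z. apply Q in Z as (q & q' & Z).
    pose proof (edges_unit N T x w HT Hw) as Uw.
    assert (Ej : side_dir N j = a \/ side_dir N j = s).
    { destruct Z as [Z|Z]; [left; symmetry; now apply (corner_congr N (S k) j q q')|].
      right; symmetry; apply (corner_congr N k j q q'); lia. }
    destruct Ej as [-> | ->]; (split; [auto|]); intros Z0.
    - apply H1. destruct (unit_parallel a w Ua Uw Z0) as [|K]; auto.
      exfalso. specialize (Es w Hw). rewrite K, det_opp_r in Dsa. lra.
    - apply H2. destruct (unit_parallel s w Us Uw Z0) as [K|K].
      + exfalso. specialize (Ea w Hw). rewrite <- K, det_opp in Ea. lra.
      + rewrite K. clear. ring. }
  apply NoDup_Permutation.
  - constructor; auto. intros H. apply in_map_iff in H as ((b & c) & E & H). simpl in E. subst b.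
    assert (Hc : In c (edges T x)).
    { apply in_app_iff. right. apply in_map_iff. exists (- s, c)%C. auto. }
    apply in_star in H as (t & Ht & E).
    destruct (tile_corner_frame _ _ _ _ (HU _ Ht) E) as (_ & _ & D).
    rewrite det_opp_l in D. specialize (Es c Hc). lra.
  - constructor; auto. intros H. apply in_map_iff in H as ((b & c) & E & H). simpl in E. subst c.
    assert (Hc : In b (edges T x)).
    { apply in_app_iff. left. apply in_map_iff. exists (b, a)%C. auto. }
    apply in_star in H as (t & Ht & E).
    destruct (tile_corner_frame _ _ _ _ (HU _ Ht) E) as (_ & _ & D).
    rewrite det_opp in D. specialize (Ea b Hc). lra.
  - assert (Nas : a <> (- s)%C).
    { intros K. rewrite K, det_opp_r, det_self in Dsa. lra. }
    assert (L : forall w, In w (edges T x) -> w <> (- s)%C -> In w (map fst (star T x))).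
    { intros w Hw Nw. destruct (I w (rot90 w)) as (e0 & He0 & K); auto; [|tauto|].
      - intros ->. rewrite det_rot90; auto; lra.
      - eapply star_left_of_edge; eauto. }
    assert (R : forall w, In w (edges T x) -> w <> a -> In w (map snd (star T x))).
    { intros w Hw Nw. destruct (I w (- rot90 w)%C) as (e0 & He0 & K); auto; [tauto| |].
      - intros ->. replace (- rot90 (- s))%C with (rot90 s).
        + rewrite det_rot90; auto; lra.
        + clear. clearbody s. unfold rot90. coords. f_equal; ring.
      - eapply star_right_of_edge; eauto. }
    assert (M : forall w, In w (map fst (star T x)) \/ In w (map snd (star T x)) ->
              In w (edges T x)) by (intros w; unfold edges; rewrite in_app_iff; auto).
    intros w. simpl. split; intros [<-|Hw].
    + right. apply R; auto.
    + destruct (classic (a = w)); auto.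
    + right. apply L; auto.
    + destruct (classic ((- s)%C = w)); auto.
Qed.

(** * Discrete holomorphic functions *)

Definition discrete_holomorphic (T : list rhombus) (f : C -> C) : Prop :=
  forall t (x a b : C), In t T -> tile_corner t x = Some (a, b) ->
    ((f (x + b) - f (x + a)) * (a + b) = (f (x + a + b) - f x) * (b - a))%C.

(** The defect of the trapezoidal increments around a tile is, up to sign, [c] times the defect of
    the holomorphy equation of [f], so they are closed. The same equation of [f] then gives that of
    [F]. *)
Lemma discrete_integral N T f (c : C) :
  rhombus_tiling N T -> discrete_holomorphic T f ->
  exists F, discrete_holomorphic T F /\
    forall x w, In w (edges T x) -> (F (x + w) - F x = c * w * (f x + f (x + w)))%C.
Proof.
  intros HT Hf. pose proof HT as (HU & _).
  destruct (edge_potential N T (fun x y => c * (y - x) * (f x + f y))%C HT) as [F HF].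
  - intros x y. ring.
  - intros t x a b Ht E. specialize (Hf t x a b Ht E).
    set (fx := f x) in *. set (fa := f (x + a)%C) in *. set (fb := f (x + b)%C) in *.
    set (fz := f (x + a + b)%C) in *.
    assert (Z : ((fb - fa) * (a + b) - (fz - fx) * (b - a) = 0)%C) by (rewrite Hf; ring).
    transitivity (c * (x + b - x) * (fx + fb) + c * (x + a + b - (x + b)) * (fb + fz)
       - c * ((fb - fa) * (a + b) - (fz - fx) * (b - a)))%C; [ring|rewrite Z; ring].
  - assert (HF' : forall x w, In w (edges T x) ->
              (F (x + w) - F x = c * w * (f x + f (x + w)))%C).
    { intros x w Hw. rewrite HF by auto. ring. }
    exists F. split; auto. intros t x a b Ht E.
    assert (Ea : In a (edges T x)) by (apply in_edges; eauto).
    assert (Eb : In b (edges T x)) by (apply in_edges; eauto).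
    assert (Eab : In b (edges T (x + a)%C)).
    { apply in_edges. exists t, (- a)%C. split; auto. left. apply tile_corner_next; auto. }
    apply HF' in Ea, Eb, Eab. specialize (Hf t x a b Ht E).
    set (fx := f x) in *. set (fa := f (x + a)%C) in *. set (fb := f (x + b)%C) in *.
    set (fz := f (x + a + b)%C) in *.
    assert (Z : ((fb - fa) * (a + b) - (fz - fx) * (b - a) = 0)%C) by (rewrite Hf; ring).
    replace (F (x + b) - F (x + a))%C with ((F (x + b) - F x) - (F (x + a) - F x))%C by ring.
    replace (F (x + a + b) - F x)%C
      with ((F (x + a + b) - F (x + a)) + (F (x + a) - F x))%C by ring.
    rewrite Ea, Eb, Eab.
    transitivity ((c * b * (fa + fz) + c * a * (fx + fa)) * (b - a) +
       c * b * ((fb - fa) * (a + b) - (fz - fx) * (b - a)))%C; [ring|rewrite Z; ring].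
Qed.

(** * Discrete exponentials and their sums *)

Lemma cis_plus x y : cis (x + y) = (cis x * cis y)%C.
Proof. unfold cis, Cmult. simpl. rewrite cos_plus, sin_plus. f_equal; ring. Qed.

Lemma cis_0 : cis 0 = 1%C.
Proof. unfold cis. now rewrite cos_0, sin_0. Qed.

Lemma cis_plus_1_neq_0 x : 0 <= x < PI -> (cis x + 1 <> 0)%C.
Proof.
  intros H E. apply (f_equal fst) in E. simpl in E.
  assert (cos PI < cos x) by (apply cos_decreasing_1; lra).
  rewrite cos_PI in H0. lra.
Qed.

(** With [w = cis (angle N)], the trapezoidal increment along side [k] is proportional to
    [w ^ k (w ^ (n k) + w ^ (n (k + 1)))], that is to [w ^ ((n + 1) k) (1 + w ^ n)]. A constant
    factor turns this into the increment of [w ^ ((n + 1) k)]. *)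
Lemma discrete_exponential N T n :
  (2 <= N)%nat -> rhombus_tiling N T -> (n < N)%nat ->
  exists f, discrete_holomorphic T f /\
    forall k, f (corner N k) = cis (INR n * INR k * angle N).
Proof.
  intros HN HT. induction n as [|n IH]; intros Hn.
  - exists (fun _ => 1%C). split.
    + intros t x a b _ _. ring.
    + intros k. simpl. now rewrite !Rmult_0_l, cis_0.
  - destruct IH as (f & Hf & Hb); [lia|].
    (* The bound on [n] keeps [w ^ n] away from -1. *)
    assert (NZ : (cis (INR n * angle N) + 1 <> 0)%C).
    { apply cis_plus_1_neq_0. pose proof (angle_pos N ltac:(lia)).
      rewrite <- (angle_spec N ltac:(lia)). pose proof (pos_INR n).
      assert (INR n < INR N) by (apply lt_INR; lia). nra. }
    destruct (discrete_integral N T f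
      ((cis (INR (S n) * angle N) - 1) / (cis (INR n * angle N) + 1))%C HT Hf) as (F & HF & E).
    (* The added constant fixes the value 1 at corner 0. *)
    exists (fun x => F x - F (corner N 0) + 1)%C. split.
    + intros t x a b Ht Ec. specialize (HF t x a b Ht Ec).
      transitivity ((F (x + b) - F (x + a)) * (a + b))%C; [ring|]. rewrite HF. ring.
    + induction k as [|k IHk].
      * simpl INR at 2. rewrite Rmult_0_r, Rmult_0_l, cis_0. ring.
      * specialize (E (corner N k) (side_dir N k) (side_is_edge N T k HN HT)).
        rewrite <- corner_S, !Hb, side_dir_cis in E.
        transitivity ((F (corner N (S k)) - F (corner N k)) +
           (F (corner N k) - F (corner N 0) + 1))%C; [ring|].
        rewrite E, IHk. clear E IHk.
        replace (INR (S n) * INR (S k) * angle N) with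
          (INR (S n) * INR k * angle N + INR (S n) * angle N) by (rewrite !S_INR; ring).
        replace (INR n * INR (S k) * angle N) with
          (INR n * INR k * angle N + INR n * angle N) by (rewrite !S_INR; ring).
        replace (INR (S n) * INR k * angle N) with
          (INR n * INR k * angle N + INR k * angle N) by (rewrite !S_INR; ring).
        rewrite !cis_plus. field. auto.
Qed.

Fixpoint cis_sum (M : nat) (x : R) : C :=
  match M with
  | O => 0%C
  | S m => (cis_sum m x + cis (INR m * x))%C
  end.

Lemma discrete_holomorphic_mult T f (c : C) :
  discrete_holomorphic T f -> discrete_holomorphic T (fun x => c * f x)%C.
Proof.
  intros H t x a b Ht E. specialize (H t x a b Ht E).
  transitivity (c * ((f (x + b) - f (x + a)) * (a + b)))%C; [ring|]. rewrite H. ring.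
Qed.

Lemma discrete_dirichlet_kernel N T k0 M :
  (2 <= N)%nat -> rhombus_tiling N T -> (M <= N)%nat ->
  exists f, discrete_holomorphic T f /\
    forall k, f (corner N k) = cis_sum M ((INR k - INR k0) * angle N).
Proof.
  intros HN HT. induction M as [|M IH]; intros HM.
  - exists (fun _ => 0%C). split; auto. intros t x a b _ _. ring.
  - destruct IH as (f & Hf & Ef); [lia|].
    destruct (discrete_exponential N T M HN HT ltac:(lia)) as (g & Hg & Eg).
    (* The constant phase recentres the mode of frequency [M] at corner [k0]. *)
    exists (fun x => f x + cis (- (INR M * INR k0 * angle N)) * g x)%C. split.
    + apply (discrete_holomorphic_mult T g (cis (- (INR M * INR k0 * angle N)))) in Hg.
      intros t x a b Ht E. specialize (Hf t x a b Ht E). specialize (Hg t x a b Ht E).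
      cbv beta in *.
      set (e := cis (- (INR M * INR k0 * angle N))) in *. clearbody e.
      transitivity ((f (x + b) - f (x + a)) * (a + b) +
        (e * g (x + b)%C - e * g (x + a)%C) * (a + b))%C; [ring|].
      rewrite Hf, Hg. ring.
    + intros k. rewrite Ef, Eg. simpl. f_equal. rewrite <- cis_plus. f_equal. ring.
Qed.

Lemma cis_sum_0 M : fst (cis_sum M 0) = INR M.
Proof.
  induction M as [|M IH]; [reflexivity|]. rewrite S_INR. cbn [cis_sum].
  simpl fst. rewrite IH, Rmult_0_r, cos_0. reflexivity.
Qed.

Lemma cis_sum_fst M x :
  2 * sin (x / 2) * fst (cis_sum M x) = sin (INR M * x - x / 2) + sin (x / 2).
Proof.
  induction M as [|M IH].
  - simpl. rewrite Rmult_0_l, Rminus_0_l, sin_neg. ring.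
  - cbn [cis_sum]. unfold Cplus. cbn [fst]. rewrite Rmult_plus_distr_l, IH, S_INR.
    replace ((INR M + 1) * x - x / 2) with (INR M * x + x / 2) by field.
    unfold cis. cbn [fst]. rewrite sin_plus, sin_minus. ring.
Qed.

Lemma cis_sum_snd M x :
  2 * sin (x / 2) * snd (cis_sum M x) = cos (x / 2) - cos (INR M * x - x / 2).
Proof.
  induction M as [|M IH].
  - simpl. rewrite Rmult_0_l, Rminus_0_l, cos_neg. ring.
  - cbn [cis_sum]. unfold Cplus. cbn [snd]. rewrite Rmult_plus_distr_l, IH, S_INR.
    replace ((INR M + 1) * x - x / 2) with (INR M * x + x / 2) by field.
    unfold cis. cbn [snd]. rewrite cos_plus, cos_minus. ring.
Qed.

(** * Currents as differences of the conjugate function *)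

Definition lsum (l : list R) : R := fold_right Rplus 0 l.

Lemma lsum_permutation l l' : Permutation l l' -> lsum l = lsum l'.
Proof. unfold lsum. induction 1; simpl in *; lra. Qed.

(* Diagonals of a rhombus are orthogonal, so multiplication by [i] times the conductance
   turns one difference quotient into the other. *)
Lemma conjugate_current (a b F G : C) :
  unit_vec a -> unit_vec b -> 0 < det a b -> (F * (a + b) = G * (b - a))%C ->
  vnorm (b - a)%C / vnorm (a + b)%C * fst G = snd F.
Proof.
  intros Ua Ub D E.
  set (q := fst (a + b)%C * fst (a + b)%C + snd (a + b)%C * snd (a + b)%C).
  assert (Hq : 0 < q).
  { unfold q. revert D. clear. destruct a as [a1 a2], b as [b1 b2]. coords. intros D.
    destruct (Req_dec (a1 + b1) 0) as [Z1|N1];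
      [|apply Rsqr_pos_lt in N1; pose proof (Rle_0_sqr (a2 + b2)); unfold Rsqr in *; lra].
    destruct (Req_dec (a2 + b2) 0) as [Z2|N2];
      [|apply Rsqr_pos_lt in N2; pose proof (Rle_0_sqr (a1 + b1)); unfold Rsqr in *; lra].
    exfalso. replace b1 with (- a1) in D by lra. replace b2 with (- a2) in D by lra. lra. }
  (* [r] turns out to be the conductance: [b - a] is [i r] times [a + b] because [a] and [b] have
     equal length. *)
  set (r := 2 * det a b / q).
  assert (Hr : 0 < r) by (apply Rdiv_lt_0_compat; lra).
  assert (Er : (b - a = (0, r) * (a + b))%C).
  { assert (Q : r * q = 2 * det a b) by (unfold r; field; lra).
    clear - Q Hq Ua Ub. apply injective_projections; apply Rmult_eq_reg_r with q; try lra.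
    - transitivity (- (r * q) * snd (a + b)%C).
      + rewrite Q. unfold q. destruct a as [a1 a2], b as [b1 b2]. coords.
        transitivity (- (2 * (a1 * b2 - a2 * b1)) * (a2 + b2) +
          (a1 + b1) * ((b1 * b1 + b2 * b2) - (a1 * a1 + a2 * a2)));
          [ring|rewrite Ua, Ub; ring].
      + simpl. ring.
    - transitivity ((r * q) * fst (a + b)%C).
      + rewrite Q. unfold q. destruct a as [a1 a2], b as [b1 b2]. coords.
        transitivity (2 * (a1 * b2 - a2 * b1) * (a1 + b1) +
          (a2 + b2) * ((b1 * b1 + b2 * b2) - (a1 * a1 + a2 * a2)));
          [ring|rewrite Ua, Ub; ring].
      + simpl. ring. }
  assert (EF : F = (G * (0, r))%C).
  { rewrite Er in E.
    assert (NZ : (a + b <> 0)%C).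
    { intros Z. unfold q in Hq. rewrite Z in Hq. simpl in Hq. lra. }
    replace F with (F * (a + b) / (a + b))%C by (field; auto). rewrite E. field. auto. }
  assert (En : vnorm (b - a)%C = r * vnorm (a + b)%C).
  { rewrite Er. unfold vnorm. transitivity (sqrt (r * r * q)).
    - f_equal. unfold q. clearbody r. clear. coords. ring.
    - rewrite sqrt_mult, sqrt_square by nra. reflexivity. }
  assert (Hn : 0 < vnorm (a + b)%C) by (unfold vnorm; apply sqrt_lt_R0; exact Hq).
  rewrite En, EF. simpl. field. lra.
Qed.

(** Each tile at [x] contributes the increment of the imaginary part from [x + a] to [x + b].
    Cancellation between tiles is left to the permutations of the star. *)
Lemma inflow_conjugate T col f (x : C) :
  (forall t, In t T -> unit_rhombus t) -> proper_colouring T col ->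
  discrete_holomorphic T f -> col x = true ->
  inflow T col (fun y => fst (f y)) x =
    lsum (map (fun w => snd (f (x + w)%C)) (map snd (star T x))) -
    lsum (map (fun w => snd (f (x + w)%C)) (map fst (star T x))).
Proof.
  intros HU HC Hf Hx. induction T as [|t T IH].
  - unfold inflow. simpl. ring.
  - rewrite inflow_cons, IH.
    2: intros; apply HU; simpl; auto. 2: intros t' Ht'; apply HC; simpl; auto.
    2: intros t' y a b Ht'; apply Hf; simpl; auto.
    assert (Ut : unit_rhombus t) by (apply HU; simpl; auto).
    cbn [star]. destruct (tile_corner t x) as [[a b]|] eqn:E.
    + rewrite (tile_current_corner col _ t x a b); auto; [|apply HC; simpl; auto].
      destruct (tile_corner_frame _ _ _ _ Ut E) as (Ua & Ub & D).
      pose proof (conjugate_current a b _ _ Ua Ub D (Hf t x a b (or_introl eq_refl) E)) as K.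
      change (fst (f (x + a + b)%C) - fst (f x)) with (fst (f (x + a + b) - f x)%C).
      rewrite K. simpl. ring.
    + rewrite tile_current_off; [ring|]. intros Hv.
      apply tile_corner_complete in Hv as (a & b & Hv); auto. congruence.
Qed.

(** * Green's identity and the response matrix *)

Lemma lsum_zero {A : Type} (g : A -> R) (l : list A) :
  (forall x, In x l -> g x = 0) -> lsum (map g l) = 0.
Proof.
  unfold lsum. induction l as [|x l IH]; simpl; intros H; [reflexivity|].
  rewrite H, IH by auto. ring.
Qed.

Lemma lsum_plus {A : Type} (g h : A -> R) (l : list A) :
  lsum (map (fun x => g x + h x) l) = lsum (map g l) + lsum (map h l).
Proof. unfold lsum. induction l as [|x l IH]; simpl; [ring|]. rewrite IH. ring. Qed.

Lemma lsum_single (g : C -> R) (l : list C) (p : C) :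
  NoDup l -> In p l -> (forall x, In x l -> x <> p -> g x = 0) -> lsum (map g l) = g p.
Proof.
  induction 1 as [|x l Hx Hl IH]; [intros []|]. intros Hp Hg. cbn.
  change (g x + lsum (map g l) = g p). destruct Hp as [->|Hp].
  - rewrite lsum_zero; [ring|]. intros y Hy. apply Hg; simpl; auto. congruence.
  - rewrite IH; auto; [|intros; apply Hg; simpl; auto].
    rewrite Hg; simpl; auto; [ring|]. congruence.
Qed.

(** Both sides are the energy form of one resistor, [- c (U p1 - U p2) (V p1 - V p2)], which is
    symmetric in [U] and [V]. *)
Lemma tile_current_pairing col U V t (X : list C) :
  unit_rhombus t -> coloured_tile col t -> NoDup X ->
  (forall x : C, In x (verts t) -> col x = true -> In x X) ->
  lsum (map (fun x => U x * tile_current col V x t) X) =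
  lsum (map (fun x => V x * tile_current col U x t) X).
Proof.
  intros (_ & _ & Hd) (C1 & C2 & C3 & C4) HX Hin.
  assert (P : exists (p1 p2 : C) c, black_diag col t = (p1, p2, c) /\ p1 <> p2 /\
              In p1 X /\ In p2 X).
  { unfold black_diag. unfold verts in Hin. destruct (col (rA t)) eqn:E.
    - exists (rA t), (rC t), (vnorm (vsub (ru t) (rv t)) / vnorm (vadd (ru t) (rv t))).
      split; auto. split; [|split; apply Hin; simpl; auto].
      + intros K. apply Hd. unfold rA, rC in K. destruct t as [[p1 p2] [u1 u2] [v1 v2]].
        clear - K. coords. injection K as K1 K2.
        replace u1 with (- v1) by lra. replace u2 with (- v2) by lra. ring.
      + destruct (col (rC t)), (col (rB t)); congruence.
    - exists (rB t), (rD t), (vnorm (vadd (ru t) (rv t)) / vnorm (vsub (ru t) (rv t))).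
      split; auto. split; [|split; apply Hin; simpl; auto].
      + intros K. apply Hd. unfold rB, rD in K. destruct t as [[p1 p2] [u1 u2] [v1 v2]].
        clear - K. coords. injection K as K1 K2.
        replace u1 with v1 by lra. replace u2 with v2 by lra. ring.
      + destruct (col (rB t)); congruence.
      + destruct (col (rD t)); congruence. }
  destruct P as (p1 & p2 & c & E & Hne & H1 & H2).
  assert (S : forall U V : C -> R, lsum (map (fun x => U x * tile_current col V x t) X) =
            U p1 * (c * (V p2 - V p1)) + U p2 * (c * (V p1 - V p2))).
  { intros U' V'. unfold tile_current. rewrite E.
    transitivity (lsum (map (fun x =>
      (if pt_eqb x p1 then U' x * (c * (V' p2 - V' p1)) else 0) +
      (if pt_eqb x p2 then U' x * (c * (V' p1 - V' p2)) else 0)) X)).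
    - f_equal. apply map_ext. intros x.
      destruct (pt_eqb x p1) eqn:E1, (pt_eqb x p2) eqn:E2; try ring.
      apply pt_eqb_eq in E1, E2. congruence.
    - rewrite lsum_plus, (lsum_single _ X p1), (lsum_single _ X p2); auto.
      + now rewrite !pt_eqb_refl.
      + intros x _ Hx. now rewrite pt_eqb_neq.
      + intros x _ Hx. now rewrite pt_eqb_neq. }
  rewrite !S. ring.
Qed.

(** The symmetry for single tiles adds up; [X] stays fixed in the induction so that all tiles are
    summed over the same vertices. *)
Lemma green_identity T col U V (X : list C) :
  (forall t, In t T -> unit_rhombus t) -> proper_colouring T col -> NoDup X ->
  (forall x : C, is_vertex T x -> col x = true -> In x X) ->
  lsum (map (fun x => U x * inflow T col V x) X) =
  lsum (map (fun x => V x * inflow T col U x) X).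
Proof.
  intros HU HC HX. induction T as [|t T IH]; intros Hin.
  - rewrite !lsum_zero; auto; intros x _; unfold inflow; simpl; ring.
  - assert (S : forall U V : C -> R, lsum (map (fun x => U x * inflow (t :: T) col V x) X) =
       lsum (map (fun x => U x * tile_current col V x t) X) +
       lsum (map (fun x => U x * inflow T col V x) X)).
    { intros U' V'. rewrite <- lsum_plus. f_equal. apply map_ext. intros x.
      rewrite inflow_cons. ring. }
    rewrite !S. f_equal.
    + apply tile_current_pairing; auto.
      * apply HU; simpl; auto.
      * apply HC; simpl; auto.
      * intros x Hx. apply Hin. exists t; simpl; auto.
    + apply IH.
      * intros; apply HU; simpl; auto.
      * intros t' Ht'. apply HC; simpl; auto.
      * intros x (t' & Ht' & Hx). apply Hin. exists t'; simpl; auto.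
Qed.

Lemma coloured_edge N T col (x w : C) :
  rhombus_tiling N T -> proper_colouring T col -> In w (edges T x) ->
  col (x + w)%C = negb (col x).
Proof.
  intros (HU & _) HC Hw. apply in_edges in Hw as (t & c & Ht & E).
  destruct (HC t Ht) as (C1 & C2 & C3 & C4).
  assert (K : exists u v : C, ccw_sides t = (u, v) /\
    ((x = rb t /\ (w = u \/ w = v)) \/
     (x = (rb t + u)%C /\ (w = v \/ w = (- u)%C)) \/
     (x = (rb t + u + v)%C /\ (w = (- u)%C \/ w = (- v)%C)) \/
     (x = (rb t + v)%C /\ (w = (- v)%C \/ w = u)))).
  { destruct E as [E|E]; apply tile_corner_cases in E as (u & v & E & S); auto;
      exists u, v; (split; [auto|]); tauto. }
  destruct K as (u & v & E' & K).
  destruct (ccw_sides_spec t u v (HU t Ht) E') as (_ & _ & _ & S).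
  unfold rA, rB, rC, rD in *. change vadd with Cplus in *.
  assert (X1 : forall P : C, (P + u + v + - u)%C = (P + v)%C) by (intros; ring).
  assert (X2 : forall P : C, (P + v + u)%C = (P + u + v)%C) by (intros; ring).
  destruct S as [[Eu Ev]|[Eu Ev]]; rewrite Eu, Ev in *; clear E Eu Ev E';
  destruct K as [[-> [-> | ->]]|[[-> [-> | ->]]|[[-> [-> | ->]]|[-> [-> | ->]]]]];
  rewrite ?X1, ?Cplus_opp_cancel, ?X2 in *;
  repeat match goal with |- context [col ?z] => destruct (col z) end;
  simpl; try reflexivity; try congruence;
  repeat match goal with H : context [col ?z] |- _ => destruct (col z) end; congruence.
Qed.

Lemma corner_colour N T col s n :
  (2 <= N)%nat -> rhombus_tiling N T -> proper_colouring T col ->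
  col (corner N s) = true -> col (corner N (s + n)) = Nat.even n.
Proof.
  intros HN HT HC Hs. induction n as [|n IH].
  - now rewrite Nat.add_0_r.
  - rewrite Nat.add_succ_r, corner_S, (coloured_edge N T col _ _ HT HC), IH.
    + now rewrite Nat.even_succ, Nat.negb_even.
    + now apply side_is_edge.
Qed.

Lemma Bvert_corner N s p : (1 <= N)%nat -> Bvert N s p = corner N (s + 2 * N - 2 * p).
Proof.
  intros HN. unfold Bvert. pose proof (Nat.div_mod (s + 2 * N - 2 * p) (2 * N)).
  apply (corner_congr N _ _ ((s + 2 * N - 2 * p) / (2 * N)) 0); auto. lia.
Qed.

Lemma Bvert_black N T col s p :
  (2 <= N)%nat -> rhombus_tiling N T -> proper_colouring T col ->
  col (corner N s) = true -> (p < N)%nat -> col (Bvert N s p) = true.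
Proof.
  intros HN HT HC Hs Hp. rewrite Bvert_corner by lia.
  replace (s + 2 * N - 2 * p)%nat with (s + 2 * (N - p))%nat by lia.
  rewrite (corner_colour N T col) by auto. rewrite Nat.even_mul. reflexivity.
Qed.

(** By [star_corner], all imaginary parts cancel except those at the two neighbouring corners. *)
Lemma inflow_conjugate_corner N T col f k :
  (2 <= N)%nat -> rhombus_tiling N T -> proper_colouring T col ->
  discrete_holomorphic T f -> col (corner N (S k)) = true ->
  inflow T col (fun y => fst (f y)) (corner N (S k)) =
    snd (f (corner N k)) - snd (f (corner N (S (S k)))).
Proof.
  intros HN HT HC Hf Hk. pose proof HT as (HU & _).
  rewrite inflow_conjugate; auto.
  pose proof (star_corner N T k HN HT) as P.
  apply (Permutation_map (fun w => snd (f (corner N (S k) + w)%C))), lsum_permutation in P.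
  unfold lsum in *. simpl map in P. simpl fold_right in P.
  rewrite (corner_S N (S k)).
  replace (corner N k) with (corner N (S k) + - side_dir N k)%C.
  - change (vadd (corner N k) (side_dir N k)) with (corner N (S k)) in P. lra.
  - rewrite corner_S. apply Cplus_opp_cancel.
Qed.

(** * Cotangents and the response formula *)

(** [N x] is an odd multiple of pi, so the two cosines in the closed form add up and leave a
    cotangent. *)
Lemma cis_sum_snd_odd N (a b : nat) :
  (1 <= N)%nat -> let x := (2 * (INR a - INR b) - 1) * angle N in
  sin (x / 2) <> 0 -> snd (cis_sum N x) = cos (x / 2) / sin (x / 2).
Proof.
  intros HN x Hx. pose proof (cis_sum_snd N x) as E.
  assert (K : cos (INR N * x - x / 2) = - cos (x / 2)).
  { replace (INR N * x - x / 2) with (- (x / 2) - PI + 2 * (INR a - INR b) * PI)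
      by (unfold x; rewrite <- (angle_spec N HN); ring).
    (* The multiple of pi may be negative; a shift by [2 * INR b * PI] makes periodicity over the
       natural numbers applicable. *)
    rewrite <- (cos_period _ b).
    replace (- (x / 2) - PI + 2 * (INR a - INR b) * PI + 2 * INR b * PI) with
      (- (x / 2) - PI + 2 * INR a * PI) by ring.
    rewrite cos_period, cos_minus, cos_PI, sin_PI, cos_neg. ring. }
  rewrite K in E. field_simplify_eq; auto. lra.
Qed.

(** The identity [cot u - cot v = sin (v - u) / (sin u sin v)] at half-angles that differ by
    [angle N]. *)
Lemma response_difference N (a b : nat) (x1 x2 : R) :
  (1 <= N)%nat ->
  x1 = (2 * (INR a - INR b) - 1) * angle N ->
  x2 = (2 * (INR a - INR b) + 1) * angle N ->
  sin (x1 / 2) <> 0 -> sin (x2 / 2) <> 0 ->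
  / INR N * snd (cis_sum N x1) - / INR N * snd (cis_sum N x2) =
  sin (angle N) / (INR N * sin (x1 / 2) * sin (x2 / 2)).
Proof.
  intros HN E1 E2 N1 N2.
  assert (K1 : snd (cis_sum N x1) = cos (x1 / 2) / sin (x1 / 2)).
  { subst x1. now apply cis_sum_snd_odd. }
  assert (K2 : snd (cis_sum N x2) = cos (x2 / 2) / sin (x2 / 2)).
  { replace x2 with ((2 * (INR (S a) - INR b) - 1) * angle N) in * by (rewrite E2, S_INR; ring).
    now apply cis_sum_snd_odd. }
  rewrite K1, K2.
  replace (sin (angle N)) with (sin (x2 / 2 - x1 / 2)) by (f_equal; subst; field).
  rewrite sin_minus. assert (INR N <> 0) by (apply not_0_INR; lia). field. auto.
Qed.

Lemma response_formula_cis_sum N p q :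
  (1 <= N)%nat -> (p < N)%nat -> (q < N)%nat ->
  / INR N * snd (cis_sum N ((2 * (INR q - INR p) - 1) * angle N)) -
  / INR N * snd (cis_sum N ((2 * (INR q - INR p) + 1) * angle N)) =
  response_formula N (natdist p q).
Proof.
  intros HN Hp Hq. assert (NN : INR N <> 0) by (apply not_0_INR; lia).
  set (d := natdist p q).
  assert (Hd : (d < N)%nat) by (unfold d, natdist; lia).
  set (y1 := (2 * INR d - 1) * angle N / 2). set (y2 := (2 * INR d + 1) * angle N / 2).
  assert (S2 : sin y2 <> 0).
  { apply Rgt_not_eq. replace y2 with (INR (2 * d + 1) * angle N / 2).
    - apply sin_fraction_pos; lia.
    - unfold y2. rewrite plus_INR, mult_INR. simpl. field. }
  (* For [d = 0] this sine is negative, so only nonvanishing is claimed. *)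
  assert (S1 : sin y1 <> 0).
  { destruct (Nat.eq_dec d 0) as [E|E].
    - replace y1 with (- (angle N / 2)) by (unfold y1; rewrite E; simpl; field).
      rewrite sin_neg. pose proof (sin_half_angle_pos N HN). lra.
    - apply Rgt_not_eq. replace y1 with (INR (2 * d - 1) * angle N / 2).
      + apply sin_fraction_pos; lia.
      + unfold y1. rewrite minus_INR, mult_INR by lia. simpl. field. }
  assert (R : response_formula N d = sin (angle N) / (INR N * sin y1 * sin y2)).
  { unfold response_formula, y1, y2, angle.
    replace ((2 * INR d - 1) * PI / (2 * INR N)) with ((2 * INR d - 1) * (PI / INR N) / 2)
      by (field; auto).
    replace ((2 * INR d + 1) * PI / (2 * INR N)) with ((2 * INR d + 1) * (PI / INR N) / 2)
      by (field; auto).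
    reflexivity. }
  rewrite R.
  destruct (le_ge_dec p q) as [L|L].
  - assert (Ed : INR d = INR q - INR p).
    { rewrite <- minus_INR by auto. f_equal. unfold d, natdist. lia. }
    rewrite (response_difference N q p) with
      (x1 := (2 * (INR q - INR p) - 1) * angle N) (x2 := (2 * (INR q - INR p) + 1) * angle N);
      rewrite <- ?Ed; auto.
  - assert (Ed : INR q - INR p = - INR d).
    { replace (INR d) with (INR p - INR q); [ring|].
      rewrite <- minus_INR by auto. f_equal. unfold d, natdist. lia. }
    (* When [q <= p] the two half-angles are exchanged with opposite signs, which leaves the product
       of sines unchanged. *)
    assert (X1 : (2 * (INR q - INR p) - 1) * angle N / 2 = - y2) by (rewrite Ed; unfold y2; field).
    assert (X2 : (2 * (INR q - INR p) + 1) * angle N / 2 = - y1) by (rewrite Ed; unfold y1; field).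
    rewrite (response_difference N q p) with
      (x1 := (2 * (INR q - INR p) - 1) * angle N) (x2 := (2 * (INR q - INR p) + 1) * angle N);
      auto; rewrite ?X1, ?X2, ?sin_neg; try lra.
    field. auto.
Qed.

(** The solution is the real part of the mean of the [N] Fourier modes centred at [Bvert N s q]; its
    boundary currents come from the imaginary part at the neighbouring white corners. *)
Lemma dirichlet_sol_explicit N T col s q :
  (2 <= N)%nat -> rhombus_tiling N T -> proper_colouring T col ->
  (s < 2 * N)%nat -> col (corner N s) = true -> (q < N)%nat ->
  exists U, dirichlet_sol N T col s q U /\
    forall p, (p < N)%nat -> inflow T col U (Bvert N s p) = response_formula N (natdist p q).
Proof.
  intros HN HT HC Hs Hcs Hq. assert (HN1 : (1 <= N)%nat) by lia.
  pose proof HT as (HU & _). assert (NN : INR N <> 0) by (apply not_0_INR; lia).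
  set (k0 := (s + 2 * N - 2 * q)%nat).
  destruct (discrete_dirichlet_kernel N T k0 N HN HT (le_n N)) as (g & Hg & Eg).
  apply (discrete_holomorphic_mult T g (RtoC (/ INR N))) in Hg.
  set (f := (fun x => RtoC (/ INR N) * g x)%C) in Hg.
  assert (Ef1 : forall k, fst (f (corner N k)) =
            / INR N * fst (cis_sum N ((INR k - INR k0) * angle N))).
  { intros k. unfold f. rewrite Eg. simpl. ring. }
  assert (Ef2 : forall k, snd (f (corner N k)) =
            / INR N * snd (cis_sum N ((INR k - INR k0) * angle N))).
  { intros k. unfold f. rewrite Eg. simpl. ring. }
  clearbody f. exists (fun x => fst (f x)). split; [split; [|split]|].
  (* At the centre all [N] modes equal 1. *)
  - rewrite Bvert_corner by auto. fold k0. rewrite Ef1.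
    replace ((INR k0 - INR k0) * angle N) with 0 by ring. rewrite cis_sum_0. field. auto.
  - intros x Hx Hcx (_ & k & Hk & Hb) Hne.
    assert (Ec : exists j, x = corner N j).
    { apply (boundary_vertex_corner N T) in Hb as [->| ->]; eauto. }
    destruct Ec as (j & ->).
    destruct (corner_offset N j k0 HN1) as (r & a & b & Hr & E).
    destruct (corner_congr N j (k0 + r) a b HN1 E) as [Ej _]. rewrite Ej in *.
    rewrite Ef1. rewrite Bvert_corner in Hne by auto. fold k0 in Hne.
    unfold k0 in Hcx. replace (s + 2 * N - 2 * q + r)%nat with (s + (2 * (N - q) + r))%nat in Hcx by lia.
    rewrite (corner_colour N T col) in Hcx by auto.
    rewrite Nat.even_add, Nat.even_mul in Hcx. simpl in Hcx.
    (* Two black corners differ by an even number of sides. *)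
    destruct (Nat.even r) eqn:Er; [|discriminate].
    apply Nat.even_spec in Er as (i & ->).
    assert (Hi : (i <> 0)%nat).
    { intros ->. apply Hne. f_equal. lia. }
    set (y := (INR (k0 + 2 * i) - INR k0) * angle N).
    assert (Ey : y / 2 = INR (2 * i) * angle N / 2).
    { unfold y. rewrite plus_INR. field. }
    assert (Sy : 0 < sin (y / 2)) by (rewrite Ey; apply sin_fraction_pos; lia).
    pose proof (cis_sum_fst N y) as F.
    (* For the even offset [2 i], [N y] is a multiple of [2 pi], so the numerator of the kernel
       vanishes. *)
    replace (INR N * y - y / 2) with (- (y / 2) + 2 * INR i * PI) in F.
    + rewrite sin_period, sin_neg in F.
      assert (Z : fst (cis_sum N y) = 0) by (apply Rmult_eq_reg_l with (2 * sin (y / 2)); lra).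
      rewrite Z. ring.
    + unfold y. rewrite <- (angle_spec N HN1), plus_INR, mult_INR. simpl. ring.
  - intros x Hx Hcx Hb. rewrite inflow_conjugate by auto.
    pose proof (star_interior N T x HN HT Hx Hb) as P.
    apply (Permutation_map (fun w => snd (f (x + w)%C))), lsum_permutation in P. lra.
  - intros p Hp. pose proof (Bvert_black N T col s p HN HT HC Hcs Hp) as B.
    set (k := (s + 2 * N - 2 * p - 1)%nat).
    assert (Ep : Bvert N s p = corner N (S k)).
    { rewrite Bvert_corner by auto. f_equal. unfold k. lia. }
    rewrite Ep in *.
    etransitivity; [apply (inflow_conjugate_corner N T col f k); auto|]. rewrite !Ef2.
    rewrite <- (response_formula_cis_sum N p q) by auto.
    (* The corners next to [Bvert N s p] have the odd offsets [2 (q - p) - 1] and [2 (q - p) + 1]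
       from [k0]. *)
    assert (Ek : INR k - INR k0 = 2 * (INR q - INR p) - 1).
    { unfold k, k0. rewrite !minus_INR, !plus_INR, !mult_INR by lia. simpl. ring. }
    rewrite !S_INR.
    replace (INR k + 1 + 1 - INR k0) with (2 * (INR q - INR p) + 1) by lra.
    now rewrite Ek.
Qed.

Theorem mainTheorem6 :
  forall (N : nat) (T : list rhombus) (col : pt -> bool) (s p q : nat),
    (2 <= N)%nat ->
    rhombus_tiling N T ->
    proper_colouring T col ->
    (s < 2 * N)%nat -> col (corner N s) = true ->
    (p < N)%nat -> (q < N)%nat ->
    (exists V, dirichlet_sol N T col s p V) /\
    (forall V, dirichlet_sol N T col s p V ->
       response_entry N T col s q V = response_formula N (natdist p q)).
Proof.
  intros N T col s p q HN HT HC Hs Hcs Hp Hq. pose proof HT as (HU & _).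
  split.
  { destruct (dirichlet_sol_explicit N T col s p HN HT HC Hs Hcs Hp) as (U & HU' & _). eauto. }
  intros V HV.
  (* [U] has its source at [q] and [V] at [p]: Green's identity equates the current of [V] at [q]
     with that of [U] at [p]. *)
  destruct (dirichlet_sol_explicit N T col s q HN HT HC Hs Hcs Hq) as (U & HUd & HUr).
  unfold response_entry. rewrite <- (HUr p Hp).
  set (X := nodup (fun x y : C => excluded_middle_informative (x = y))
     (filter col (flat_map (fun t => verts t : list C) T))).
  assert (NX : NoDup X) by apply NoDup_nodup.
  assert (HX : forall x : C, In x X <-> is_vertex T x /\ col x = true).
  { intros x. unfold X. rewrite nodup_In, filter_In, in_flat_map. reflexivity. }
  pose proof (green_identity T col U V X HU HC NX (fun x a b => proj2 (HX x) (conj a b))) as G.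
  assert (BX : forall r, (r < N)%nat -> In (Bvert N s r : C) X).
  { intros r Hr. apply HX. split; [|eapply Bvert_black; eauto].
    rewrite Bvert_corner by lia. now apply corner_vertex. }
  (* In the sum, [U] kills the boundary vertices other than its source, and harmonicity of [V] kills
     the interior ones. *)
  assert (Sel : forall r r' U V, dirichlet_sol N T col s r U -> dirichlet_sol N T col s r' V ->
     (r < N)%nat -> lsum (map (fun x => U x * inflow T col V x) X) = inflow T col V (Bvert N s r)).
  { intros r r' U' V' (D1 & D2 & _) (_ & _ & D3) Hr.
    rewrite (lsum_single _ X (Bvert N s r)); auto.
    - rewrite D1. ring.
    - intros x Hx Hne. apply HX in Hx as [Hx Hcx].
      destruct (classic (on_bdry N x)) as [Hb|Hb].
      + rewrite D2; auto. ring.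
      + rewrite D3; auto. ring. }
  rewrite (Sel q p U V), (Sel p q V U) in G; auto.
Qed.
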